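(* The semantic typing relation $\models e:\tau$, viewed as a set of pairs $(e,\tau)$ with $e$ a closed expression of the core language and $\tau$ a type (generated by $\tau ::= \mathtt{int} \mid \mathtt{bool} \mid \tau\to\tau$), is co-recursively enumerable; that is, the set of pairs $(e,\tau)$ with $\not\models e:\tau$ is recursively enumerable.
   Context: **Core language.** Values: $v ::= n\ (n\in\mathbb Z) \mid b\ (b\in\mathbb B=\{\mathtt{true},\mathtt{false}\}) \mid \mathtt{fun}\ x \to e$. Expressions: $e ::= v \mid x \mid e\ e \mid e\odot e \mid \mathtt{if}\ e\ \mathtt{then}\ e\ \mathtt{else}\ e \mid e\sim p \mid \mathtt{pick\_i} \mid \mathtt{pick\_b} \mid \mathtt{ERROR}$, with $x$ a variable, $\odot\in\{+,-,<,=,\mathtt{and},\mathtt{or},\mathtt{xor}\}$ and patterns $p ::= \mathtt{int}\mid\mathtt{bool}\mid\mathtt{fun}$. $\mathtt{ERROR}$ is not a value. Types: $\tau ::= \mathtt{int}\mid\mathtt{bool}\mid\tau\to\tau$. The language is untyped; bound, free and closed are standard. **Operational semantics.** Reduction contexts: $R ::= \bullet \mid R\ e \mid e\ R \mid R\odot e \mid v\odot R \mid \mathtt{if}\ R\ \mathtt{then}\ e\ \mathtt{else}\ e \mid R\sim p$; $R[[e]]$ is $R$ with $\bullet$ replaced by $e$. The single-step relation $\rightarrow^1$ on closed expressions is the least relation such that: (Red) if a redex $r\rightarrow^1 e$ by one of the basic rules below, then $R[[r]]\rightarrow^1 R[[e]]$; (Err) if $e\rightarrow^1\mathtt{ERROR}$,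 then $R[[e]]\rightarrow^1\mathtt{ERROR}$; also $R[[\mathtt{ERROR}]]\rightarrow^1\mathtt{ERROR}$ for $R\neq\bullet$. Basic rules: $n_1+n_2\rightarrow^1$ their integer sum if $n_1,n_2\in\mathbb Z$; $v_1+v_2\rightarrow^1\mathtt{ERROR}$ if $v_1$ or $v_2$ is not an integer; the other operators $\odot$ behave analogously (integer operands for $-,<,=$; boolean operands for $\mathtt{and},\mathtt{or},\mathtt{xor}$; otherwise $\mathtt{ERROR}$). $(\mathtt{fun}\ x\to e)\ v\rightarrow^1 e[v/x]$; $v\ v'\rightarrow^1\mathtt{ERROR}$ if $v$ is not a function value. $\mathtt{if}\ \mathtt{true}\ \mathtt{then}\ e\ \mathtt{else}\ e'\rightarrow^1 e$; $\mathtt{if}\ \mathtt{false}\ \mathtt{then}\ e\ \mathtt{else}\ e'\rightarrow^1 e'$; $\mathtt{if}\ v\ \mathtt{then}\ e\ \mathtt{else}\ e'\rightarrow^1\mathtt{ERROR}$ if $v$ is not boolean. $\mathtt{pick\_i}\rightarrow^1 n$ for every $n\in\mathbb Z$; $\mathtt{pick\_b}\rightarrow^1 b$ for every $b\in\mathbb B$. $v\sim p\rightarrow^1\mathtt{true}$ if $v$ is respectively an integer ($p=\mathtt{int}$), a boolean ($p=\mathtt{bool}$), a function value ($p=\mathtt{fun}$), and $v\sim p\rightarrow^1\mathtt{false}$ otherwise. $\rightarrow^*$ is the reflexive transitive closure of $\rightarrow^1$; $e\not\rightarrow^* e'$ is its negation. **Semantic typing** ($e$ closed, values closed), by induction on $\tau$: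 - $\models e:\mathtt{int}$ iff $e\not\rightarrow^*\mathtt{ERROR}$ and for all $v$, if $e\rightarrow^* v$ then $v\in\mathbb Z$. - $\models e:\mathtt{bool}$ iff $e\not\rightarrow^*\mathtt{ERROR}$ and for all $v$, if $e\rightarrow^* v$ then $v\in\mathbb B$. - $\models e:\tau_1\to\tau_2$ iff $e\not\rightarrow^*\mathtt{ERROR}$ and for all $v_f$, if $e\rightarrow^* v_f$, then for all $v$, if $\models v:\tau_1$ then $\models v_f\ v:\tau_2$. *)

(* Defs.v *)
From Stdlib Require Import ZArith Arith Lia Bool Relations Cantor.
From Stdlib Require Fin Vector.

(** * Partial recursive functions *)

(** [recfun n]: Kleene's mu-recursive functions of [n] arguments.  In [RComp]
    the [k] inner functions are given as a family over the finite type
    [Fin.t k]; [RPrec] recurses on, and [RMu] searches over, the first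
    argument. *)
Inductive recfun : nat -> Set :=
| RZero : forall n, recfun n
| RSucc : recfun 1
| RProj : forall n, Fin.t n -> recfun n
| RComp : forall n k, recfun k -> (Fin.t k -> recfun n) -> recfun n
| RPrec : forall n, recfun n -> recfun (S (S n)) -> recfun (S n)
| RMu   : forall n, recfun (S n) -> recfun n.

Arguments RZero {n}.
Arguments RProj {n} _.
Arguments RComp {n k} _ _.
Arguments RPrec {n} _ _.
Arguments RMu {n} _.

(** [computes f v y]: the partial function [f] is defined at [v], with value
    [y].  Primitive recursion is [h(0,v) = f(v)],
    [h(k+1,v) = g(k,h(k,v),v)]; the minimization of [f] takes the value [y]
    at [v] when [f(y,v) = 0] and [f(z,v)] is defined and nonzero for every
    [z < y]. *)
Fixpoint computes {n : nat} (f : recfun n) : Vector.t nat n -> nat -> Prop :=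
  match f in recfun n return Vector.t nat n -> nat -> Prop with
  | RZero => fun _ y => y = 0
  | RSucc => fun v y => y = S (Vector.hd v)
  | RProj i => fun v y => y = Vector.nth v i
  | @RComp _ k f gs => fun v y =>
      exists w : Vector.t nat k,
        (forall i, computes (gs i) v (Vector.nth w i)) /\ computes f w y
  | RPrec f g => fun v =>
      nat_rect (fun _ => nat -> Prop)
        (computes f (Vector.tl v))
        (fun k P y => exists z, P z /\
           computes g (Vector.cons _ k _ (Vector.cons _ z _ (Vector.tl v))) y)
        (Vector.hd v)
  | RMu f => fun v y =>
      computes f (Vector.cons _ y _ v) 0 /\
      forall z, z < y -> exists u, computes f (Vector.cons _ z _ v) (S u)
  end.

Definition recursively_enumerable (A : nat -> Prop) : Prop :=
  exists f : recfun 1, forall m,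
    A m <-> exists y, computes f (Vector.cons _ m _ (Vector.nil _)) y.

(** Sets of other finite objects are identified with the sets of their
    Goedel numbers. *)
Definition re_via {X : Type} (code : X -> nat) (A : X -> Prop) : Prop :=
  recursively_enumerable (fun m => exists x, A x /\ m = code x).

(** Co-recursive enumerability of [A] as a subset of [U]. *)
Definition co_re_via {X : Type} (code : X -> nat) (U A : X -> Prop) : Prop :=
  re_via code (fun x => U x /\ ~ A x).

(** * The core language *)

Definition var := nat.

Inductive op : Set := OAdd | OSub | OLt | OEq | OAnd | OOr | OXor.

Inductive pat : Set := PInt | PBool | PFun.

Inductive expr : Set :=
| EInt (n : Z)
| EBool (b : bool)
| EFun (x : var) (e : expr)
| EVar (x : var)
| EApp (e1 e2 : expr)
| EOp (o : op) (e1 e2 : expr)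
| EIf (e e1 e2 : expr)
| ETest (e : expr) (p : pat)
| EPickI
| EPickB
| EError.

Inductive value : expr -> Prop :=
| value_int n : value (EInt n)
| value_bool b : value (EBool b)
| value_fun x e : value (EFun x e).

Fixpoint free (x : var) (e : expr) : Prop :=
  match e with
  | EInt _ | EBool _ | EPickI | EPickB | EError => False
  | EVar y => x = y
  | EFun y e => x <> y /\ free x e
  | EApp e1 e2 | EOp _ e1 e2 => free x e1 \/ free x e2
  | EIf e e1 e2 => free x e \/ free x e1 \/ free x e2
  | ETest e _ => free x e
  end.

Definition closed (e : expr) : Prop := forall x, ~ free x e.

Definition closed_value (v : expr) : Prop := value v /\ closed v.

(** [subst x v e] is [e[v/x]].  It is only meant for closed [v], so no renaming
    of bound variables is needed. *)
Fixpoint subst (x : var) (v e : expr) : expr :=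
  match e with
  | EInt _ | EBool _ | EPickI | EPickB | EError => e
  | EVar y => if Nat.eqb x y then v else e
  | EFun y e' => if Nat.eqb x y then e else EFun y (subst x v e')
  | EApp e1 e2 => EApp (subst x v e1) (subst x v e2)
  | EOp o e1 e2 => EOp o (subst x v e1) (subst x v e2)
  | EIf e0 e1 e2 => EIf (subst x v e0) (subst x v e1) (subst x v e2)
  | ETest e' p => ETest (subst x v e') p
  end.

(** * Operational semantics *)

Inductive rctx : Set :=
| CHole
| CAppL (R : rctx) (e : expr)
| CAppR (e : expr) (R : rctx)
| COpL (o : op) (R : rctx) (e : expr)
| COpR (o : op) (v : expr) (Hv : value v) (R : rctx)
| CIf (R : rctx) (e1 e2 : expr)
| CTest (R : rctx) (p : pat).

Fixpoint plug (R : rctx) (e : expr) : expr :=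
  match R with
  | CHole => e
  | CAppL R e2 => EApp (plug R e) e2
  | CAppR e1 R => EApp e1 (plug R e)
  | COpL o R e2 => EOp o (plug R e) e2
  | COpR o v _ R => EOp o v (plug R e)
  | CIf R e1 e2 => EIf (plug R e) e1 e2
  | CTest R p => ETest (plug R e) p
  end.

Definition delta (o : op) (v1 v2 : expr) : expr :=
  match o, v1, v2 with
  | OAdd, EInt m, EInt n => EInt (m + n)
  | OSub, EInt m, EInt n => EInt (m - n)
  | OLt, EInt m, EInt n => EBool (m <? n)%Z
  | OEq, EInt m, EInt n => EBool (m =? n)%Z
  | OAnd, EBool a, EBool b => EBool (andb a b)
  | OOr, EBool a, EBool b => EBool (orb a b)
  | OXor, EBool a, EBool b => EBool (xorb a b)
  | _, _, _ => EError
  end.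

Definition matches (v : expr) (p : pat) : bool :=
  match v, p with
  | EInt _, PInt | EBool _, PBool | EFun _ _, PFun => true
  | _, _ => false
  end.

Inductive basic : expr -> expr -> Prop :=
| basic_op o v1 v2 :
    value v1 -> value v2 -> basic (EOp o v1 v2) (delta o v1 v2)
| basic_beta x e v :
    value v -> basic (EApp (EFun x e) v) (subst x v e)
| basic_app_err v v' :
    value v -> value v' -> (forall x e, v <> EFun x e) ->
    basic (EApp v v') EError
| basic_if_true e1 e2 : basic (EIf (EBool true) e1 e2) e1
| basic_if_false e1 e2 : basic (EIf (EBool false) e1 e2) e2
| basic_if_err v e1 e2 :
    value v -> (forall b, v <> EBool b) -> basic (EIf v e1 e2) EError
| basic_pick_i n : basic EPickI (EInt n)
| basic_pick_b b : basic EPickB (EBool b)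
| basic_test v p : value v -> basic (ETest v p) (EBool (matches v p)).

(** The rules preserve closedness, so the relation is stated on all expressions
    and only ever used from closed ones. *)
Inductive step : expr -> expr -> Prop :=
| step_red R r e : basic r e -> step (plug R r) (plug R e)
| step_err R e : step e EError -> step (plug R e) EError
| step_error R : R <> CHole -> step (plug R EError) EError.

Definition steps : expr -> expr -> Prop := clos_refl_trans expr step.

(** * Semantic typing *)

Inductive ty : Set := TInt | TBool | TArr (t1 t2 : ty).

Fixpoint sem_typed (e : expr) (t : ty) {struct t} : Prop :=
  match t with
  | TInt =>
      ~ steps e EError /\
      forall v, closed_value v -> steps e v -> exists n, v = EInt n
  | TBool =>
      ~ steps e EError /\
      forall v, closed_value v -> steps e v -> exists b, v = EBool b
  | TArr t1 t2 =>
      ~ steps e EError /\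
      forall vf, closed_value vf -> steps e vf ->
      forall v, closed_value v -> sem_typed v t1 -> sem_typed (EApp vf v) t2
  end.

(** * Goedel numbering of pairs of an expression and a type *)

Definition cpair (a b : nat) : nat := Cantor.to_nat (a, b).

Definition code_Z (z : Z) : nat :=
  cpair (if (z <? 0)%Z then 1 else 0) (Z.abs_nat z).

Definition code_bool (b : bool) : nat := if b then 1 else 0.

Definition code_op (o : op) : nat :=
  match o with
  | OAdd => 0 | OSub => 1 | OLt => 2 | OEq => 3 | OAnd => 4 | OOr => 5 | OXor => 6
  end.

Definition code_pat (p : pat) : nat :=
  match p with PInt => 0 | PBool => 1 | PFun => 2 end.

Fixpoint code_expr (e : expr) : nat :=
  match e with
  | EInt n => cpair 0 (code_Z n)
  | EBool b => cpair 1 (code_bool b)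
  | EFun x e => cpair 2 (cpair x (code_expr e))
  | EVar x => cpair 3 x
  | EApp e1 e2 => cpair 4 (cpair (code_expr e1) (code_expr e2))
  | EOp o e1 e2 =>
      cpair 5 (cpair (code_op o) (cpair (code_expr e1) (code_expr e2)))
  | EIf e e1 e2 =>
      cpair 6 (cpair (code_expr e) (cpair (code_expr e1) (code_expr e2)))
  | ETest e p => cpair 7 (cpair (code_expr e) (code_pat p))
  | EPickI => cpair 8 0
  | EPickB => cpair 9 0
  | EError => cpair 10 0
  end.

Fixpoint code_ty (t : ty) : nat :=
  match t with
  | TInt => cpair 0 0
  | TBool => cpair 1 0
  | TArr t1 t2 => cpair 2 (cpair (code_ty t1) (code_ty t2))
  end.

Definition code (p : expr * ty) : nat :=
  cpair (code_expr (fst p)) (code_ty (snd p)).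

Lemma cpair_inj a b c d : cpair a b = cpair c d -> a = c /\ b = d.
Proof.
  unfold cpair. intros H. apply Cantor.to_nat_inj in H. now injection H.
Qed.

Lemma code_Z_inj z z' : code_Z z = code_Z z' -> z = z'.
Proof.
  intros H. apply cpair_inj in H. destruct H as [H1 H2].
  destruct (Z.ltb_spec z 0), (Z.ltb_spec z' 0); lia.
Qed.

Lemma code_op_inj o o' : code_op o = code_op o' -> o = o'.
Proof. now destruct o, o'. Qed.

Lemma code_pat_inj p p' : code_pat p = code_pat p' -> p = p'.
Proof. now destruct p, p'. Qed.

Lemma code_bool_inj b b' : code_bool b = code_bool b' -> b = b'.
Proof. now destruct b, b'. Qed.

Lemma code_expr_inj e e' : code_expr e = code_expr e' -> e = e'.
Proof.
  revert e'.
  induction e; intros [] H; cbn [code_expr code_ty] in H;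
    repeat match goal with
      | H : cpair _ _ = cpair _ _ |- _ => apply cpair_inj in H; destruct H
      end; try discriminate; f_equal;
    auto using code_Z_inj, code_op_inj, code_pat_inj, code_bool_inj.
Qed.

Lemma code_ty_inj t t' : code_ty t = code_ty t' -> t = t'.
Proof.
  revert t'.
  induction t; intros [] H; cbn [code_expr code_ty] in H;
    repeat match goal with
      | H : cpair _ _ = cpair _ _ |- _ => apply cpair_inj in H; destruct H
      end; try discriminate; f_equal; auto.
Qed.

Lemma code_inj p p' : code p = code p' -> p = p'.
Proof.
  destruct p, p'. intros H. apply cpair_inj in H. destruct H.
  f_equal; auto using code_expr_inj, code_ty_inj.
Qed.

(* Main.v *)
Require Import Defs.
From Stdlib Require Import ZArith Arith Lia Relations Classical List Cantor.
From Stdlib Require Fin Vector.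
Import ListNotations.

(** For each type [t] there are a checker [chk t e], which may reach [EError]
    exactly when [e] is not semantically of type [t], and a generator [gen t].
    A checker for an arrow type applies the expression to a generated argument;
    a generated function, on any argument, either checks the argument or
    returns a freshly generated result.  The crux is that [gen t] is the most
    general inhabitant of [t]: replacing a value that passes the check by
    [gen t], anywhere in a program and hereditarily, never removes a run to
    [EError].  Hence the quantification over all arguments in the definition of
    semantic typing collapses to the single argument [gen t], and non-typing is
    reachability of [EError] from [chk t e].  Derivability from a finite set of
    Horn clauses over numbers with pairing is recursively enumerable, because a
    search can be driven by an oracle naming the clause instances to use, and
    evaluation, checkers and closedness are expressed by such clauses. *)

(** * Big-step semantics *)

(** Results are values or [EError]; divergence has no result. Reduction contexts let either side of
    an application run first, so [ev_app_errr] asks nothing of [e1], whereas operators run left to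
    right and [ev_op_errr] needs a value on the left. *)
Inductive ev : expr -> expr -> Prop :=
| ev_value v : value v -> ev v v
| ev_error : ev EError EError
| ev_beta e1 e2 x b v r :
    ev e1 (EFun x b) -> ev e2 v -> value v -> ev (subst x v b) r ->
    ev (EApp e1 e2) r
| ev_app_nonfun e1 e2 v1 v2 :
    ev e1 v1 -> value v1 -> matches v1 PFun = false -> ev e2 v2 -> value v2 ->
    ev (EApp e1 e2) EError
| ev_app_errl e1 e2 : ev e1 EError -> ev (EApp e1 e2) EError
| ev_app_errr e1 e2 : ev e2 EError -> ev (EApp e1 e2) EError
| ev_op o e1 e2 v1 v2 :
    ev e1 v1 -> value v1 -> ev e2 v2 -> value v2 ->
    ev (EOp o e1 e2) (delta o v1 v2)
| ev_op_errl o e1 e2 : ev e1 EError -> ev (EOp o e1 e2) EError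
| ev_op_errr o e1 e2 v1 :
    ev e1 v1 -> value v1 -> ev e2 EError -> ev (EOp o e1 e2) EError
| ev_if e0 e1 e2 b r :
    ev e0 (EBool b) -> ev (if b then e1 else e2) r -> ev (EIf e0 e1 e2) r
| ev_if_nonbool e0 e1 e2 v :
    ev e0 v -> value v -> matches v PBool = false -> ev (EIf e0 e1 e2) EError
| ev_if_err e0 e1 e2 : ev e0 EError -> ev (EIf e0 e1 e2) EError
| ev_test e p v : ev e v -> value v -> ev (ETest e p) (EBool (matches v p))
| ev_test_err e p : ev e EError -> ev (ETest e p) EError
| ev_pick_i n : ev EPickI (EInt n)
| ev_pick_b b : ev EPickB (EBool b).

#[local] Hint Constructors value ev : core.

Lemma value_error : ~ value EError.
Proof. intros H; inversion H. Qed.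

#[local] Hint Resolve value_error : core.

Lemma delta_result o v1 v2 : value (delta o v1 v2) \/ delta o v1 v2 = EError.
Proof. destruct o, v1, v2; cbn; auto. Qed.

Lemma ev_result e r : ev e r -> value r \/ r = EError.
Proof. induction 1; auto using delta_result. Qed.

Lemma ev_final e r : value e \/ e = EError -> ev e r -> r = e.
Proof. intros [Hv | ->] H; [destruct Hv |]; inversion H; auto. Qed.

Lemma ev_of_value v r : value v -> ev v r -> r = v.
Proof. intros; apply ev_final; auto. Qed.

(** * Agreement with the small-step semantics *)

(** Inclusion of result sets. Being a congruence for reduction contexts, it lets a step under a
    context be treated at the redex alone. *)
Definition below (e e' : expr) : Prop := forall r, ev e r -> ev e' r.

Lemma below_app e1 e1' e2 e2' :
  below e1 e1' -> below e2 e2' -> below (EApp e1 e2) (EApp e1' e2').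
Proof.
  intros H1 H2 r H; inversion H; subst; eauto.
  match goal with Hv : value (EApp _ _) |- _ => inversion Hv end.
Qed.

Lemma below_op o e1 e1' e2 e2' :
  below e1 e1' -> below e2 e2' -> below (EOp o e1 e2) (EOp o e1' e2').
Proof.
  intros H1 H2 r H; inversion H; subst; eauto.
  match goal with Hv : value (EOp _ _ _) |- _ => inversion Hv end.
Qed.

Lemma below_if e0 e0' e1 e2 : below e0 e0' -> below (EIf e0 e1 e2) (EIf e0' e1 e2).
Proof.
  intros H1 r H; inversion H; subst; eauto.
  match goal with Hv : value (EIf _ _ _) |- _ => inversion Hv end.
Qed.

Lemma below_test e e' p : below e e' -> below (ETest e p) (ETest e' p).
Proof.
  intros H1 r H; inversion H; subst; eauto.
  match goal with Hv : value (ETest _ _) |- _ => inversion Hv end.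
Qed.

Lemma below_refl e : below e e.
Proof. now intros r. Qed.

Lemma below_plug R e e' : below e e' -> below (plug R e) (plug R e').
Proof.
  induction R; cbn;
    auto using below_app, below_op, below_if, below_test, below_refl.
Qed.

Lemma below_of_ev e r : value r \/ r = EError -> ev e r -> below r e.
Proof. intros Hr H s Hs; now rewrite (ev_final _ _ Hr Hs). Qed.

Lemma nonfun_matches v : (forall x e, v <> EFun x e) -> matches v PFun = false.
Proof. destruct v; cbn; intros H; auto; now destruct (H x v). Qed.

Lemma nonbool_matches v : (forall b, v <> EBool b) -> matches v PBool = false.
Proof. destruct v; cbn; intros H; auto; now destruct (H b). Qed.

Lemma below_basic r e : basic r e -> below e r.
Proof.
  destruct 1; intros s Hs;
    try (apply ev_final in Hs; [subst | now auto]);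
    eauto using nonfun_matches, nonbool_matches.
  - apply ev_final in Hs; [subst; eauto | apply delta_result].
Qed.

Lemma ev_plug_error R : ev (plug R EError) EError.
Proof. induction R; cbn; eauto. Qed.

(** Results propagate backwards along a step; iterating this turns a small-step run into a big-step
    derivation. *)
Lemma below_step e e' : step e e' -> below e' e.
Proof.
  induction 1 as [R r e H | R e H IH | R H].
  - now apply below_plug, below_basic.
  - apply below_of_ev; [now right |].
    apply below_plug with (R := R) in IH. apply IH, ev_plug_error.
  - apply below_of_ev; [now right |]. apply ev_plug_error.
Qed.

Lemma steps_ev e r : value r \/ r = EError -> steps e r -> ev e r.
Proof.
  intros Hr H. apply clos_rt_rt1n in H.
  induction H as [| e e1 r H _ IH]; [destruct Hr; subst; auto |].
  now apply (below_step _ _ H), IH.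
Qed.

Lemma step_from_error e : step EError e -> False.
Proof.
  assert (Hp : forall R a, plug R a = EError -> R = CHole /\ a = EError)
    by (intros []; cbn; now try discriminate).
  intros H. remember EError as s eqn:E in H at 1. revert E.
  induction H as [R r e H | R e H IH | R H]; intros E;
    apply Hp in E; destruct E; subst; auto.
  inversion H.
Qed.

Lemma steps_from_error e : steps EError e -> e = EError.
Proof.
  intros H; apply clos_rt_rt1n in H. inversion H; auto.
  now exfalso; eapply step_from_error; eauto.
Qed.

(** * Lifting small-step runs through contexts *)

Fixpoint ctx_comp (R S : rctx) : rctx :=
  match R with
  | CHole => S
  | CAppL R e => CAppL (ctx_comp R S) e
  | CAppR e R => CAppR e (ctx_comp R S)
  | COpL o R e => COpL o (ctx_comp R S) e
  | COpR o v Hv R => COpR o v Hv (ctx_comp R S)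
  | CIf R e1 e2 => CIf (ctx_comp R S) e1 e2
  | CTest R p => CTest (ctx_comp R S) p
  end.

Lemma plug_comp R S e : plug (ctx_comp R S) e = plug R (plug S e).
Proof. induction R; cbn; congruence. Qed.

(** The second alternative arises because an error discards the whole surrounding context in a
    single step, without passing through [plug R EError]. *)
Lemma steps_plug R e e' :
  steps e e' ->
  steps (plug R e) (plug R e') \/ e' = EError /\ steps (plug R e) EError.
Proof.
  intros H; apply clos_rt_rt1n in H.
  induction H as [e | e e1 e' H Hs IH]; [now left; apply rt_refl |].
  assert (H' : step (plug R e) (plug R e1) \/
               e1 = EError /\ step (plug R e) EError).
  { destruct H.
    - left; rewrite <- !plug_comp; now constructor.
    - right; split; auto. rewrite <- plug_comp. now constructor.
    - right; split; auto. apply step_err. now constructor. }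
  destruct H' as [H' | [-> H']].
  - destruct IH as [IH | [-> IH]]; [left | right; split; auto];
      apply rt_trans with (plug R e1); auto; now apply rt_step.
  (* Nothing steps from [EError], so the rest of the run is empty and its end is [EError]. *)
  - right; split; [| now apply rt_step].
    apply steps_from_error. now apply clos_rt1n_rt.
Qed.

Lemma steps_plug_value R e v :
  value v -> steps e v -> steps (plug R e) (plug R v).
Proof.
  intros Hv H. destruct (steps_plug R _ _ H) as [| [-> _]]; auto.
  now apply value_error in Hv.
Qed.

Lemma steps_plug_error R e : steps e EError -> steps (plug R e) EError.
Proof.
  intros H. destruct (steps_plug R _ _ H) as [H' | [_ H']]; auto.
  apply rt_trans with (1 := H').
  assert (HR : {R = CHole} + {R <> CHole}) by (destruct R; auto; now right).
  destruct HR as [-> | HR]; [apply rt_refl | apply rt_step; now constructor].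
Qed.

Lemma basic_steps r e : basic r e -> steps r e.
Proof. intros H; apply rt_step, (step_red CHole _ _ H). Qed.

Lemma basic_err_nonfun v v' :
  value v -> value v' -> matches v PFun = false -> basic (EApp v v') EError.
Proof. intros Hv Hv' Hm; constructor; auto; intros x e ->; discriminate. Qed.

Lemma basic_err_nonbool v e1 e2 :
  value v -> matches v PBool = false -> basic (EIf v e1 e2) EError.
Proof. intros Hv Hm; constructor; auto; intros b ->; discriminate. Qed.

(** Each rule is replayed by running the subexpressions in their contexts from left to right; an
    error in an argument is replayed under [CAppR e1 CHole] with [e1] still unevaluated. *)
Lemma ev_steps e r : ev e r -> steps e r.
Proof.
  induction 1 as
    [v Hv | | e1 e2 x b v r _ IH1 _ IH2 Hv _ IH3
    | e1 e2 v1 v2 _ IH1 Hv1 Hm _ IH2 Hv2 | e1 e2 _ IH | e1 e2 _ IH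
    | o e1 e2 v1 v2 _ IH1 Hv1 _ IH2 Hv2 | o e1 e2 _ IH
    | o e1 e2 v1 _ IH1 Hv1 _ IH2 | e0 e1 e2 b r _ IH1 _ IH2
    | e0 e1 e2 v _ IH Hv Hm | e0 e1 e2 _ IH | e p v _ IH Hv | e p _ IH | n | b];
    try (now apply rt_refl); try (now apply basic_steps; constructor).
  - apply rt_trans with (EApp (EFun x b) e2).
    { apply (steps_plug_value (CAppL CHole e2)); auto. }
    apply rt_trans with (EApp (EFun x b) v).
    { apply (steps_plug_value (CAppR (EFun x b) CHole)); auto. }
    apply rt_trans with (2 := IH3). now apply basic_steps; constructor.
  - apply rt_trans with (EApp v1 e2).
    { apply (steps_plug_value (CAppL CHole e2)); auto. }
    apply rt_trans with (EApp v1 v2).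
    { apply (steps_plug_value (CAppR v1 CHole)); auto. }
    now apply basic_steps, basic_err_nonfun.
  - now apply (steps_plug_error (CAppL CHole e2)).
  - now apply (steps_plug_error (CAppR e1 CHole)).
  - apply rt_trans with (EOp o v1 e2).
    { apply (steps_plug_value (COpL o CHole e2)); auto. }
    apply rt_trans with (EOp o v1 v2).
    { apply (steps_plug_value (COpR o v1 Hv1 CHole)); auto. }
    now apply basic_steps; constructor.
  - now apply (steps_plug_error (COpL o CHole e2)).
  - apply rt_trans with (EOp o v1 e2).
    { apply (steps_plug_value (COpL o CHole e2)); auto. }
    now apply (steps_plug_error (COpR o v1 Hv1 CHole)).
  - apply rt_trans with (EIf (EBool b) e1 e2).
    { apply (steps_plug_value (CIf CHole e1 e2)); auto. }
    apply rt_trans with (2 := IH2).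
    apply basic_steps; destruct b; constructor.
  - apply rt_trans with (EIf v e1 e2).
    { apply (steps_plug_value (CIf CHole e1 e2)); auto. }
    now apply basic_steps, basic_err_nonbool.
  - now apply (steps_plug_error (CIf CHole e1 e2)).
  - apply rt_trans with (ETest v p).
    { apply (steps_plug_value (CTest CHole p)); auto. }
    now apply basic_steps; constructor.
  - now apply (steps_plug_error (CTest CHole p)).
Qed.

Lemma steps_error_iff e : steps e EError <-> ev e EError.
Proof. split; auto using steps_ev, ev_steps. Qed.

Lemma steps_value_iff e v : value v -> steps e v <-> ev e v.
Proof. split; auto using steps_ev, ev_steps. Qed.

(** * Closed expressions *)

Lemma subst_not_free x v e : ~ free x e -> subst x v e = e.
Proof.
  induction e; cbn; intros H; auto;
    try (f_equal; auto; now tauto).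
  - destruct (Nat.eqb_spec x x0); auto. f_equal; auto.
  - destruct (Nat.eqb_spec x x0); congruence.
Qed.

Lemma subst_closed x v e : closed e -> subst x v e = e.
Proof. intros H; apply subst_not_free, H. Qed.

Lemma free_subst x v e y :
  closed v -> free y (subst x v e) -> free y e /\ y <> x.
Proof.
  intros Hv. induction e; cbn; try tauto.
  - destruct (Nat.eqb_spec x x0); cbn; [subst; tauto |].
    intros [? H]; apply IHe in H; tauto.
  - destruct (Nat.eqb_spec x x0); cbn; [intros H; now apply Hv in H |].
    intros ->; auto.
Qed.

Lemma closed_beta x b v : closed (EFun x b) -> closed v -> closed (subst x v b).
Proof.
  intros Hb Hv y Hy. apply free_subst in Hy; auto.
  apply (Hb y); cbn; tauto.
Qed.

Lemma closed_app e1 e2 : closed (EApp e1 e2) <-> closed e1 /\ closed e2.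
Proof. unfold closed; cbn; firstorder. Qed.

Lemma closed_op o e1 e2 : closed (EOp o e1 e2) <-> closed e1 /\ closed e2.
Proof. unfold closed; cbn; firstorder. Qed.

Lemma closed_if e0 e1 e2 :
  closed (EIf e0 e1 e2) <-> closed e0 /\ closed e1 /\ closed e2.
Proof. unfold closed; cbn; firstorder. Qed.

Lemma closed_delta o v1 v2 : closed (delta o v1 v2).
Proof. destruct o, v1, v2; cbn; intros ? []. Qed.

Lemma closed_const n b : closed (EInt n) /\ closed (EBool b) /\ closed EError.
Proof. now repeat split; intros ? ?. Qed.

Lemma ev_closed e r : ev e r -> closed e -> closed r.
Proof.
  induction 1 as
    [| | e1 e2 x b v r _ IH1 _ IH2 _ _ IH3 | | | | | | | e0 e1 e2 b r _ _ _ IH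
    | | | | | |];
    rewrite ?closed_app, ?closed_op, ?closed_if; intros Hc;
    try apply (closed_const 0 true); try apply closed_delta;
    try (intros ? []); auto.
  - apply IH3, closed_beta; tauto.
  - apply IH; destruct b; tauto.
Qed.

(** * Checkers and generators *)

(** At base types an operator with a neutral operand serves as the type test. Applying
    [EFun 0 (gen t2)] to the check is sequencing: the check runs, its value is dropped, [gen t2]
    follows. The branch returning [gen t2] directly is there because the check may diverge. No
    variable is captured: generators are closed, and a checker never places its argument under a
    binder. *)
Fixpoint chk (t : ty) (e : expr) {struct t} : expr :=
  match t with
  | TInt => EOp OAdd e (EInt 0)
  | TBool => EOp OAnd e (EBool true)
  | TArr t1 t2 => chk t2 (EApp e (gen t1))
  end
with gen (t : ty) {struct t} : expr :=
  match t with
  | TInt => EPickI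
  | TBool => EPickB
  | TArr t1 t2 =>
      EFun 0 (EIf EPickB (gen t2) (EApp (EFun 0 (gen t2)) (chk t1 (EVar 0))))
  end.

Definition passes (t : ty) (e : expr) : Prop := ~ ev (chk t e) EError.

Lemma free_chk_gen t :
  (forall x e, free x (chk t e) <-> free x e) /\ closed (gen t).
Proof.
  induction t as [| | t1 [IHc1 IHg1] t2 [IHc2 IHg2]]; cbn.
  1,2: split; [tauto | intros x []].
  split.
  - intros x e. rewrite IHc2. cbn. specialize (IHg1 x). tauto.
  - intros x [Hx H]. cbn in H. rewrite IHc1 in H. cbn in H.
    specialize (IHg2 x). tauto.
Qed.

Lemma closed_gen t : closed (gen t).
Proof. apply free_chk_gen. Qed.

Lemma closed_chk t e : closed e -> closed (chk t e).
Proof. intros H x Hx. apply free_chk_gen in Hx. now apply (H x). Qed.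

#[local] Hint Resolve closed_gen closed_chk : core.

Lemma subst_chk x v t e : subst x v (chk t e) = chk t (subst x v e).
Proof.
  revert e; induction t as [| | t1 _ t2 IH2]; intros e; cbn; auto.
  rewrite IH2. cbn. now rewrite (subst_closed x v (gen t1)).
Qed.

Lemma below_chk t e e' : below e e' -> below (chk t e) (chk t e').
Proof.
  revert e e'; induction t; cbn; intros e e' H;
    auto using below_op, below_app, below_refl.
Qed.

(** A checker evaluates its argument first, so an error from checking [r] is also an error from
    checking [e]. *)
Lemma passes_ev t e r : ev e r -> passes t e -> passes t r.
Proof.
  intros H Hp Hr. apply Hp.
  apply (below_chk t r e); auto.
  apply below_of_ev; auto. now apply ev_result in H.
Qed.

Lemma chk_of_error t e : ev e EError -> ev (chk t e) EError.
Proof.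
  revert e; induction t; cbn; intros e H; auto.
Qed.

Lemma passes_no_error t e : passes t e -> ~ ev e EError.
Proof. intros Hp H; now apply Hp, chk_of_error. Qed.

Lemma gen_no_error t : ~ ev (gen t) EError.
Proof. destruct t; intros H; inversion H. Qed.

Lemma gen_inhabited t : exists g, ev (gen t) g /\ value g.
Proof.
  destruct t; [exists (EInt 0) | exists (EBool true) | exists (gen (TArr t1 t2))];
    cbn; auto.
Qed.

(** * Inversion of checks and of calls to generated functions *)

Ltac no_value :=
  match goal with
  | H : value (EApp _ _) |- _ => inversion H
  | H : value (EOp _ _ _) |- _ => inversion H
  | H : value (EIf _ _ _) |- _ => inversion H
  | H : value EPickI |- _ => inversion H
  | H : value EPickB |- _ => inversion H
  | H : value EError |- _ => inversion H
  end.

Lemma ev_app_inv e1 e2 r :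
  ev (EApp e1 e2) r -> ~ ev e1 EError -> ~ ev e2 EError ->
  exists v1 v2, ev e1 v1 /\ value v1 /\ ev e2 v2 /\ value v2 /\ ev (EApp v1 v2) r.
Proof.
  intros H H1 H2; inversion H; subst; try easy; try no_value.
  - exists (EFun x b), v; repeat split; eauto.
  - exists v1, v2; repeat split; eauto.
Qed.

Lemma ev_op_inv o e1 e2 r :
  ev (EOp o e1 e2) r ->
  ev e1 EError \/ exists v1, ev e1 v1 /\ value v1 /\ ev (EOp o v1 e2) r.
Proof. intros H; inversion H; subst; try no_value; eauto 7. Qed.

(** A failing check can be blamed on a single result of [e], which reduces questions about checks to
    values. *)
Lemma chk_error_inv t e :
  ev (chk t e) EError ->
  ev e EError \/ exists v, ev e v /\ value v /\ ev (chk t v) EError.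
Proof.
  revert e; induction t as [| | t1 _ t2 IH2]; intros e H; cbn in *.
  - now apply ev_op_inv.
  - now apply ev_op_inv.
  (* If [e] cannot err, a run of the application evaluates both sides to values. Below, [r] is a
     result of the application whose own check fails, with [EError] taken when the application
     itself errs. *)
  - destruct (classic (ev e EError)) as [He | He]; [now left | right].
    assert (Hr : exists r, ev (EApp e (gen t1)) r /\ ev (chk t2 r) EError).
    { destruct (IH2 _ H) as [Ha | (v & Ha & _ & Hv)]; [| eauto].
      exists EError; auto using chk_of_error. }
    destruct Hr as (r & Ha & Hr).
    pose proof (ev_result _ _ Ha) as Hres.
    apply ev_app_inv in Ha as (v1 & v2 & Hv1 & Vv1 & Hv2 & Vv2 & Ha);
      auto using gen_no_error.
    exists v1; repeat split; auto.
    apply (below_chk t2 r); auto.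
    apply below_of_ev; auto.
    apply (below_app v1 v1 v2); auto using below_refl, below_of_ev.
Qed.

Lemma passes_int v : value v -> passes TInt v -> exists n, v = EInt n.
Proof.
  intros [n | b | x e] H; eauto; destruct H; cbn.
  - now apply (ev_op OAdd (EBool b) (EInt 0) (EBool b) (EInt 0)); auto.
  - now apply (ev_op OAdd (EFun x e) (EInt 0) (EFun x e) (EInt 0)); auto.
Qed.

Lemma passes_bool v : value v -> passes TBool v -> exists b, v = EBool b.
Proof.
  intros [n | b | x e] H; eauto; destruct H; cbn.
  - now apply (ev_op OAnd (EInt n) (EBool true) (EInt n) (EBool true)); auto.
  - now apply (ev_op OAnd (EFun x e) (EBool true) (EFun x e) (EBool true)); auto.
Qed.

Lemma passes_int_const n : passes TInt (EInt n).
Proof.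
  intros H; inversion H; subst; try easy.
  repeat match goal with
    | Hv : ev (EInt _) _ |- _ => apply ev_of_value in Hv; [subst | auto]
    end; try easy.
Qed.

Lemma passes_bool_const b : passes TBool (EBool b).
Proof.
  intros H; inversion H; subst; try easy.
  repeat match goal with
    | Hv : ev (EBool _) _ |- _ => apply ev_of_value in Hv; [subst | auto]
    end; try easy.
Qed.

Lemma passes_arrow t1 t2 f g :
  passes (TArr t1 t2) f -> ev (gen t1) g -> passes t2 (EApp f g).
Proof.
  intros Hp Hg H. apply Hp. cbn.
  apply (below_chk t2 (EApp f g)); auto.
  apply below_app; [apply below_refl | apply below_of_ev; auto].
  now apply ev_result in Hg.
Qed.

Lemma subst_gen_body t1 t2 v :
  subst 0 v (EIf EPickB (gen t2) (EApp (EFun 0 (gen t2)) (chk t1 (EVar 0)))) =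
  EIf EPickB (gen t2) (EApp (EFun 0 (gen t2)) (chk t1 v)).
Proof. cbn. now rewrite subst_chk, (subst_closed 0 v (gen t2)). Qed.

Lemma gen_app_returns t1 t2 v g :
  value v -> ev (gen t2) g -> ev (EApp (gen (TArr t1 t2)) v) g.
Proof.
  intros Hv Hg. cbn [gen]. eapply ev_beta; eauto.
  rewrite subst_gen_body. now apply ev_if with true.
Qed.

Lemma gen_app_error t1 t2 v :
  value v -> ev (chk t1 v) EError -> ev (EApp (gen (TArr t1 t2)) v) EError.
Proof.
  intros Hv Hg. cbn [gen]. eapply ev_beta; eauto.
  rewrite subst_gen_body. apply ev_if with false; auto.
Qed.

Lemma ev_beta_inv x b e r :
  ev (EApp (EFun x b) e) r ->
  ev e EError /\ r = EError \/
  exists v, ev e v /\ value v /\ ev (subst x v b) r.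
Proof.
  intros H; inversion H as
    [ | | ? ? y b' v ? Hf He Vv Hb | ? ? v1 v2 Hf V1 Hm He V2
    | ? ? Hf | ? ? He | | | | | | | | | | ]; subst; try no_value; auto.
  - apply ev_of_value in Hf; auto. injection Hf as -> ->. eauto.
  - apply ev_of_value in Hf; auto. now subst.
  - inversion Hf.
Qed.

(** Both branches of the generated body end in [gen t2]; the only other outcome is an error of the
    check on the argument. *)
Lemma gen_app_inv t1 t2 v r :
  value v -> ev (EApp (gen (TArr t1 t2)) v) r ->
  ev (gen t2) r \/ r = EError /\ ev (chk t1 v) EError.
Proof.
  intros Hv H. cbn [gen] in H.
  apply ev_beta_inv in H as [[H _] | (u & Hu & _ & H)].
  { apply ev_of_value in H; auto; subst; no_value. }
  apply ev_of_value in Hu; auto. subst u. rewrite subst_gen_body in H.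
  inversion H as
    [ | | | | | | | | | ? ? ? b ? _ Hr | ? ? ? u Hu _ Hm | ? ? ? Hu | | | | ];
    subst; try no_value.
  - destruct b; auto.
    apply ev_beta_inv in Hr as [[Hr ->] | (u & _ & _ & Hr)]; auto.
    left. now rewrite subst_closed in Hr.
  - inversion Hu; now subst.
  - inversion Hu.
Qed.

(** At an arrow type the generated function meets a generated argument. By induction that argument
    passes its check, so the call cannot err, and its results come from [gen t2], which passes as
    well. *)
Lemma gen_passes t : passes t (gen t).
Proof.
  induction t as [| | t1 IH1 t2 IH2]; intros H.
  - apply chk_error_inv in H as [H | (v & H & Hv & He)]; [inversion H |].
    cbn in H. inversion H; subst; try no_value. now apply passes_int_const in He.
  - apply chk_error_inv in H as [H | (v & H & Hv & He)]; [inversion H |].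
    cbn in H. inversion H; subst; try no_value. now apply passes_bool_const in He.
  - cbn [chk] in H.
    assert (Hr : exists r, ev (EApp (gen (TArr t1 t2)) (gen t1)) r /\
                           ev (chk t2 r) EError).
    { apply chk_error_inv in H as [H | (v & H & _ & Hv)]; [| eauto].
      exists EError; auto using chk_of_error. }
    destruct Hr as (r & Ha & Hr).
    apply ev_app_inv in Ha as (v1 & v2 & Hv1 & Vv1 & Hv2 & Vv2 & Ha);
      auto using gen_no_error.
    apply ev_of_value in Hv1; [| constructor]. subst v1.
    apply gen_app_inv in Ha as [Ha | [-> Ha]]; auto.
    + exact (passes_ev t2 _ _ Ha IH2 Hr).
    + exact (passes_ev t1 _ _ Hv2 IH1 Ha).
Qed.

(** * Generators are most general *)

(** [e'] arises from [e] by replacing closed values with generators, hereditarily. In [gle_gen] the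
    check is required of [v'], so a value may be replaced after replacements inside it; [sim_beta]
    unwinds such chains. Only arrow types occur, as generators of base types are not values. *)
Inductive gle : expr -> expr -> Prop :=
| gle_int n : gle (EInt n) (EInt n)
| gle_bool b : gle (EBool b) (EBool b)
| gle_fun x e e' : gle e e' -> gle (EFun x e) (EFun x e')
| gle_var x : gle (EVar x) (EVar x)
| gle_app e1 e1' e2 e2' :
    gle e1 e1' -> gle e2 e2' -> gle (EApp e1 e2) (EApp e1' e2')
| gle_op o e1 e1' e2 e2' :
    gle e1 e1' -> gle e2 e2' -> gle (EOp o e1 e2) (EOp o e1' e2')
| gle_if e0 e0' e1 e1' e2 e2' :
    gle e0 e0' -> gle e1 e1' -> gle e2 e2' -> gle (EIf e0 e1 e2) (EIf e0' e1' e2')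
| gle_test e e' p : gle e e' -> gle (ETest e p) (ETest e' p)
| gle_pick_i : gle EPickI EPickI
| gle_pick_b : gle EPickB EPickB
| gle_error : gle EError EError
| gle_gen v v' t1 t2 :
    closed_value v -> closed_value v' -> gle v v' -> passes (TArr t1 t2) v' ->
    gle v (gen (TArr t1 t2)).

#[local] Hint Constructors gle : core.

Lemma gle_refl e : gle e e.
Proof. induction e; auto. Qed.

Lemma gle_chk t e e' : gle e e' -> gle (chk t e) (chk t e').
Proof.
  revert e e'; induction t; cbn; intros e e' H; auto using gle_refl.
Qed.

Lemma gle_subst x v v' e e' :
  gle v v' -> gle e e' -> gle (subst x v e) (subst x v' e').
Proof.
  intros Hv. induction 1; cbn [subst]; auto;
    try (destruct (Nat.eqb x x0); now auto).
  rewrite (subst_closed _ _ (gen _)) by auto.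
  rewrite (subst_closed x v) by apply H. eauto.
Qed.

(** Applying a non-function errs only once the argument has become a value, hence the appeal to
    [gen_inhabited]. *)
Lemma passes_arrow_fun t1 t2 v :
  value v -> passes (TArr t1 t2) v -> matches v PFun = true.
Proof.
  intros Hv Hp. destruct (matches v PFun) eqn:E; auto. destruct Hp.
  destruct (gen_inhabited t1) as (g & Hg & Vg).
  cbn. apply chk_of_error. eauto.
Qed.

Ltac no_closed_value :=
  match goal with
  | C : closed_value _ |- _ => destruct C as [C _]; now inversion C
  end.

Lemma gle_value v v' : gle v v' -> value v -> value v'.
Proof. destruct 1; intros Hv; inversion Hv; constructor. Qed.

(** Pattern tests cannot detect a replacement: a value replaced by a generator passes an arrow check
    after inner replacements, so it is a function, and the generator is one too. *)
Lemma gle_matches v v' p :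
  gle v v' -> value v -> matches v' p = matches v p.
Proof.
  induction 1 as [| | | | | | | | | | | v v' t1 t2 Cv Cv' H IH Hp];
    intros Hv; try easy; try no_value.
  rewrite <- IH by auto.
  pose proof (passes_arrow_fun _ _ v' (proj1 Cv') Hp) as Hm.
  now destruct v'.
Qed.

Lemma gle_error_inv e : gle EError e -> e = EError.
Proof. intros H; inversion H; auto. no_closed_value. Qed.

Lemma gle_bool_inv b e : gle (EBool b) e -> e = EBool b.
Proof.
  intros H. assert (Hm := gle_matches _ _ PFun H (value_bool b)).
  inversion H; subst; auto; discriminate.
Qed.

Lemma gle_int_inv n e : gle (EInt n) e -> e = EInt n.
Proof.
  intros H. assert (Hm := gle_matches _ _ PFun H (value_int n)).
  inversion H; subst; auto; discriminate.
Qed.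

Lemma gle_fun_inv x b e : gle (EFun x b) e -> exists y b', e = EFun y b'.
Proof. intros H; inversion H; eauto. eexists; eexists; reflexivity. Qed.

Lemma gle_delta o v1 v1' v2 v2' :
  gle v1 v1' -> gle v2 v2' -> value v1 -> value v2 ->
  delta o v1' v2' = delta o v1 v2.
Proof.
  intros H1 H2 V1 V2.
  destruct V1, V2;
    repeat match goal with
      | H : gle (EInt _) _ |- _ => apply gle_int_inv in H; subst
      | H : gle (EBool _) _ |- _ => apply gle_bool_inv in H; subst
      | H : gle (EFun _ _) _ |- _ => apply gle_fun_inv in H as (? & ? & ->)
      end; now destruct o.
Qed.

(** At base types the generator can pick the very constant; at an arrow type it is itself the
    covering value, by [gle_gen]. *)
Lemma gen_covers t v v' :
  gle v v' -> closed_value v -> closed_value v' -> passes t v' ->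
  exists g, ev (gen t) g /\ closed_value g /\ gle v g.
Proof.
  intros H Hv Hv' Hp. destruct t as [| | t1 t2].
  - destruct (passes_int v' (proj1 Hv') Hp) as [n ->]. exists (EInt n); cbn; auto.
  - destruct (passes_bool v' (proj1 Hv') Hp) as [b ->]. exists (EBool b); cbn; auto.
  - exists (gen (TArr t1 t2)). repeat split; cbn [gen]; auto.
    + apply (closed_gen (TArr t1 t2)).
    + change (gle v (gen (TArr t1 t2))). eauto.
Qed.

(** An error counts as an upper bound of every result, because only runs to [EError] have to survive
    a replacement. *)
Definition sim_result (r e' : expr) : Prop :=
  exists r', ev e' r' /\ (r' = EError \/ gle r r').

Lemma sim_error e' : ev e' EError -> forall r, sim_result r e'.
Proof. exists EError; auto. Qed.

(* Induction on the derivation of [gle f f']: the generator either finds the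
   argument ill-typed, or the argument is below a generated value [g], and
   the run of [f''] on [g] bounds the result. *)
Lemma sim_beta x b v r :
  closed_value (EFun x b) -> closed_value v -> ev (subst x v b) r ->
  (forall e', gle (subst x v b) e' -> closed e' -> sim_result r e') ->
  forall f', gle (EFun x b) f' -> closed f' ->
  forall v', gle v v' -> closed_value v' -> sim_result r (EApp f' v').
Proof.
  intros Hf Hv Hev IH f' H. remember (EFun x b) as f eqn:E. revert E.
  induction H as [| | y e e' H _ | | | | | | | |
                 | f f'' t1 t2 Hf0 Hf'' H IHH Hp]; intros E Hc v' Hvv' Hv';
    try discriminate.
  - injection E as -> ->.
    destruct (IH (subst x v' e')) as (r' & Hr' & Hrr').
    + now apply gle_subst.
    + apply closed_beta; auto. apply Hv'.
    + exists r'; split; auto. destruct Hv'; eauto.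
  - subst f.
    destruct (classic (passes t1 v')) as [Hp1 | Hp1].
    2: { apply sim_error, gen_app_error; [apply Hv' | now apply NNPP]. }
    destruct (gen_covers _ _ _ Hvv' Hv Hv' Hp1) as (g & Hg & Cg & Hvg).
    destruct (IHH Hf eq_refl (proj2 Hf'') g Hvg Cg) as (r' & Hr' & Hrr').
    pose proof (passes_arrow _ _ _ _ Hp Hg) as Hp2.
    assert (Er' : r' <> EError)
      by (intros ->; now apply passes_no_error in Hp2).
    destruct Hrr' as [-> | Hrr']; [easy |].
    assert (Hr : closed r)
      by (apply (ev_closed _ _ Hev), closed_beta; [apply Hf | apply Hv]).
    assert (Cr' : closed r').
    { apply (ev_closed _ _ Hr'), closed_app; split; [apply Hf'' | apply Cg]. }
    destruct (ev_result _ _ Hev) as [Vr | ->];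
      [| now apply gle_error_inv in Hrr'].
    destruct (gen_covers t2 r r' Hrr') as (g2 & Hg2 & _ & Hrg2).
    + now split.
    + split; auto. now apply gle_value with r.
    + now apply passes_ev with (EApp f'' g).
    + exists g2; split; auto. apply gen_app_returns; auto. apply Hv'.
Qed.

Lemma gle_app_inv e1 e2 e' :
  gle (EApp e1 e2) e' ->
  exists e1' e2', e' = EApp e1' e2' /\ gle e1 e1' /\ gle e2 e2'.
Proof. intros H; inversion H; subst; eauto 6. no_closed_value. Qed.

Lemma gle_op_inv o e1 e2 e' :
  gle (EOp o e1 e2) e' ->
  exists e1' e2', e' = EOp o e1' e2' /\ gle e1 e1' /\ gle e2 e2'.
Proof. intros H; inversion H; subst; eauto 6. no_closed_value. Qed.

Lemma gle_if_inv e0 e1 e2 e' :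
  gle (EIf e0 e1 e2) e' ->
  exists e0' e1' e2', e' = EIf e0' e1' e2' /\
    gle e0 e0' /\ gle e1 e1' /\ gle e2 e2'.
Proof. intros H; inversion H; subst; eauto 9. no_closed_value. Qed.

Lemma gle_test_inv e p e' :
  gle (ETest e p) e' -> exists e0', e' = ETest e0' p /\ gle e e0'.
Proof. intros H; inversion H; subst; eauto 6. no_closed_value. Qed.

(** Replacement by generators keeps every result up to [sim_result]. The induction follows the
    evaluation; the one case where the replaced function differs in behaviour, a call, is
    [sim_beta]. *)
Lemma sim e r :
  ev e r -> closed e -> forall e', gle e e' -> closed e' -> sim_result r e'.
Proof.
  (* For each evaluated subexpression: either its replacement errs, and then in most cases the whole
     expression does, or it yields a related closed value and the same rule applies. *)
  assert (Hval : forall e' v, sim_result v e' -> closed e' -> value v ->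
            ev e' EError \/ exists v', ev e' v' /\ value v' /\ closed v' /\ gle v v').
  { intros e' v (v' & Hv' & [-> | Hvv']) Hc Hv; auto.
    right; exists v'; repeat split; auto;
      [now apply gle_value with v | now apply ev_closed with e']. }
  assert (Herr : forall e', sim_result EError e' -> ev e' EError).
  { intros e' (r' & Hr' & [-> | H]); auto.
    apply gle_error_inv in H; now subst. }
  induction 1 as
    [v Hv | | e1 e2 x b v r He1 IH1 He2 IH2 Hv Hb IH3
    | e1 e2 v1 v2 _ IH1 Hv1 Hm _ IH2 Hv2 | e1 e2 _ IH | e1 e2 _ IH
    | o e1 e2 v1 v2 _ IH1 Hv1 _ IH2 Hv2 | o e1 e2 _ IH
    | o e1 e2 v1 _ IH1 Hv1 _ IH2 | e0 e1 e2 b r _ IH1 _ IH2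
    | e0 e1 e2 v _ IH Hv Hm | e0 e1 e2 _ IH | e p v _ IH Hv | e p _ IH | n | b];
    intros Hc e' Hee' Hc';
    try (apply gle_app_inv in Hee' as (e1' & e2' & -> & H1 & H2);
         apply closed_app in Hc as [Hc1 Hc2];
         apply closed_app in Hc' as [Hc1' Hc2']);
    try (apply gle_op_inv in Hee' as (e1' & e2' & -> & H1 & H2);
         apply closed_op in Hc as [Hc1 Hc2];
         apply closed_op in Hc' as [Hc1' Hc2']);
    try (apply gle_if_inv in Hee' as (e0' & e1' & e2' & -> & H0 & H1 & H2);
         apply closed_if in Hc as (Hc0 & Hc1 & Hc2);
         apply closed_if in Hc' as (Hc0' & Hc1' & Hc2'));
    try (apply gle_test_inv in Hee' as (e0' & -> & H0));
    try (now apply sim_error; auto).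
  - exists e'; split; eauto using gle_value.
  - apply gle_error_inv in Hee'; subst. now apply sim_error.
  - destruct (Hval e1' (EFun x b)) as [|(f' & Hf' & Vf' & Cf' & Hff')]; auto.
    { now apply sim_error; auto. }
    destruct (Hval e2' v) as [|(v' & Hv' & Vv' & Cv' & Hvv')]; auto.
    { now apply sim_error; auto. }
    assert (Cf : closed (EFun x b)) by now apply (ev_closed _ _ He1).
    assert (Cv : closed v) by now apply (ev_closed _ _ He2).
    destruct (sim_beta x b v r) with (f' := f') (v' := v')
      as (r' & Hr' & Hrr'); auto; try now split.
    { apply IH3. now apply closed_beta. }
    exists r'; split; auto.
    apply (below_app f' _ v'); auto using below_of_ev.
  - destruct (Hval e1' v1) as [|(v1' & Hv1' & Vv1' & _ & Hvv1)]; auto.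
    { now apply sim_error; auto. }
    destruct (Hval e2' v2) as [|(v2' & Hv2' & Vv2' & _ & Hvv2)]; auto.
    { now apply sim_error; auto. }
    apply sim_error. eapply ev_app_nonfun; eauto.
    now rewrite (gle_matches _ _ PFun Hvv1).
  - destruct (Hval e1' v1) as [|(v1' & Hv1' & Vv1' & _ & Hvv1)]; auto.
    { now apply sim_error; auto. }
    destruct (Hval e2' v2) as [|(v2' & Hv2' & Vv2' & _ & Hvv2)]; auto.
    { apply sim_error; eauto. }
    exists (delta o v1' v2'); split; eauto.
    right. rewrite (gle_delta o v1 v1' v2 v2') by auto. apply gle_refl.
  - destruct (Hval e1' v1) as [|(v1' & Hv1' & Vv1' & _ & Hvv1)]; auto.
    { now apply sim_error; auto. }
    apply sim_error; eauto.
  - destruct (Hval e0' (EBool b)) as [|(b' & Hb' & Vb' & _ & Hbb')]; auto.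
    { now apply sim_error; auto. }
    apply gle_bool_inv in Hbb'; subst.
    destruct (IH2 ltac:(destruct b; auto) (if b then e1' else e2'))
      as (r' & Hr' & Hrr'); [destruct b; auto.. |].
    exists r'; split; eauto.
  - destruct (Hval e0' v) as [|(v' & Hv' & Vv' & _ & Hvv)]; auto.
    { now apply sim_error; auto. }
    apply sim_error. eapply ev_if_nonbool; eauto.
    now rewrite (gle_matches _ _ PBool Hvv).
  - destruct (Hval e0' v) as [|(v' & Hv' & Vv' & _ & Hvv)]; auto.
    { now apply sim_error; auto. }
    exists (EBool (matches v' p)); split; eauto.
    right. now rewrite (gle_matches _ _ p Hvv).
  - inversion Hee'; subst; [| no_closed_value]. exists (EInt n); auto.
  - inversion Hee'; subst; [| no_closed_value]. exists (EBool b); auto.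
Qed.

(** At an arrow type each direction uses one half of generality: [gen t1] is itself a legitimate
    argument, and it covers every legitimate argument. *)
Lemma sem_typed_passes t e : closed e -> sem_typed e t <-> passes t e.
Proof.
  revert e; induction t as [| | t1 IH1 t2 IH2]; intros e Hc; cbn [sem_typed];
    rewrite steps_error_iff; split.
  - intros [He Hv] H.
    apply chk_error_inv in H as [H | (v & H & Vv & H')]; auto.
    destruct (Hv v) as [n ->].
    + split; auto. now apply ev_closed with e.
    + now apply steps_value_iff.
    + now apply passes_int_const in H'.
  - intros Hp; split; [now apply passes_no_error in Hp |].
    intros v [Vv _] Hv. apply steps_value_iff in Hv; auto.
    apply passes_int; auto. now apply passes_ev with e.
  - intros [He Hv] H.
    apply chk_error_inv in H as [H | (v & H & Vv & H')]; auto.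
    destruct (Hv v) as [n ->].
    + split; auto. now apply ev_closed with e.
    + now apply steps_value_iff.
    + now apply passes_bool_const in H'.
  - intros Hp; split; [now apply passes_no_error in Hp |].
    intros v [Vv _] Hv. apply steps_value_iff in Hv; auto.
    apply passes_bool; auto. now apply passes_ev with e.
  - intros [He Hf] H.
    apply chk_error_inv in H as [H | (f & H & Vf & H')]; auto.
    assert (Cf : closed f) by now apply ev_closed with e.
    assert (Hr : exists r, ev (EApp f (gen t1)) r /\ ev (chk t2 r) EError).
    { cbn in H'. apply chk_error_inv in H' as [H' | (r & H' & _ & Hr)]; [| eauto].
      exists EError; auto using chk_of_error. }
    destruct Hr as (r & Ha & Hr).
    apply ev_app_inv in Ha as (f' & g & Hf' & _ & Hg & Vg & Ha);
      auto using gen_no_error.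
    2: { intros Hfe. apply ev_of_value in Hfe; subst; auto. }
    apply ev_of_value in Hf'; auto. subst f'.
    assert (Cg : closed g) by now apply ev_closed with (gen t1).
    (* [g] is semantically of type [t1]: it is a result of [gen t1], which passes its own check. *)
    assert (Hs : sem_typed (EApp f g) t2).
    { apply Hf; try now split.
      - now apply steps_value_iff.
      - apply IH1; auto. apply passes_ev with (gen t1); auto using gen_passes. }
    apply IH2 in Hs; [| now apply closed_app].
    apply (passes_ev _ _ _ Ha Hs Hr).
  - intros Hp; split; [now apply passes_no_error in Hp |].
    intros f [Vf Cf] Hf v Cv Hv. apply steps_value_iff in Hf; auto.
    apply IH1 in Hv; [| apply Cv].
    (* The argument [v] is traded for a generated [g] above it. By [sim], an error in checking [f v]
       would reappear in checking [f g], which passes. *)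
    destruct (gen_covers t1 v v (gle_refl v) Cv Cv Hv) as (g & Hg & Cg & Hvg).
    apply IH2; [apply closed_app; split; auto; apply Cv |].
    intros H.
    assert (Hs : sim_result EError (chk t2 (EApp f g))).
    { eapply sim; eauto.
      - apply closed_chk, closed_app; split; auto; apply Cv.
      - apply gle_chk. auto using gle_refl.
      - apply closed_chk, closed_app; split; auto; apply Cg. }
    assert (Hs' : ev (chk t2 (EApp f g)) EError).
    { destruct Hs as (r' & Hr' & [-> | E]); auto.
      apply gle_error_inv in E; now subst. }
    revert Hs'. apply passes_arrow with t1; auto. now apply passes_ev with e.
Qed.

(** * Recursive functions *)

#[local] Arguments cpair : simpl never.

(** A [Set] rather than a proposition: composition collects the witnesses into a family over
    [Fin.t], which thus needs no choice principle. *)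
Definition total_rec {n} (f : Vector.t nat n -> nat) : Set :=
  {rf : recfun n | forall v y, computes rf v y <-> y = f v}.

Definition rec1 (f : nat -> nat) : Set :=
  total_rec (fun v : Vector.t nat 1 => f (Vector.hd v)).

Definition rec2 (f : nat -> nat -> nat) : Set :=
  total_rec (fun v : Vector.t nat 2 => f (Vector.hd v) (Vector.hd (Vector.tl v))).

Lemma total_ext {n} (f g : Vector.t nat n -> nat) :
  (forall v, f v = g v) -> total_rec f -> total_rec g.
Proof.
  intros E [rf Hrf]. exists rf. intros v y. now rewrite Hrf, E.
Qed.

Lemma rec1_ext f g : (forall x, f x = g x) -> rec1 f -> rec1 g.
Proof. intros E; apply total_ext; auto. Qed.

Lemma total_proj {n} (i : Fin.t n) : total_rec (fun v => Vector.nth v i).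
Proof. exists (RProj i). now cbn. Qed.

Lemma total_fst {n} : total_rec (fun v : Vector.t nat (S n) => Vector.hd v).
Proof.
  apply (total_ext (fun v => Vector.nth v Fin.F1)); [| apply total_proj].
  intros v; apply (Vector.caseS' v); reflexivity.
Qed.

Lemma total_snd {n} :
  total_rec (fun v : Vector.t nat (S (S n)) => Vector.hd (Vector.tl v)).
Proof.
  apply (total_ext (fun v => Vector.nth v (Fin.FS Fin.F1))); [| apply total_proj].
  intros v; apply (Vector.caseS' v); intros x w; apply (Vector.caseS' w); reflexivity.
Qed.

Lemma total_zero {n} : total_rec (fun _ : Vector.t nat n => 0).
Proof. exists RZero. now cbn. Qed.

Lemma rec1_S : rec1 S.
Proof. exists RSucc. now cbn. Qed.

Lemma total_comp {n k} (f : Vector.t nat k -> nat)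
  (h : Vector.t nat n -> Vector.t nat k) :
  total_rec f -> (forall i, total_rec (fun v => Vector.nth (h v) i)) ->
  total_rec (fun v => f (h v)).
Proof.
  intros [rf Hf] Hh. exists (RComp rf (fun i => proj1_sig (Hh i))).
  intros v y. cbn. split.
  - intros (w & Hw & Hy). apply Hf in Hy. subst y. f_equal.
    apply Vector.eq_nth_iff. intros i ? <-.
    specialize (Hw i). now apply (proj2_sig (Hh i)) in Hw.
  - intros ->. exists (h v). split; [| now apply Hf].
    intros i. now apply (proj2_sig (Hh i)).
Qed.

Lemma total_comp1 {n} (f : nat -> nat) (g : Vector.t nat n -> nat) :
  rec1 f -> total_rec g -> total_rec (fun v => f (g v)).
Proof.
  intros Hf Hg.
  apply (total_comp (fun v => f (Vector.hd v)) (fun v => Vector.cons _ (g v) _ (Vector.nil _)));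
    auto.
  intros i. apply (Fin.caseS' i); auto. intros j. now apply Fin.case0.
Qed.

Lemma total_comp2 {n} (f : nat -> nat -> nat) (g h : Vector.t nat n -> nat) :
  rec2 f -> total_rec g -> total_rec h -> total_rec (fun v => f (g v) (h v)).
Proof.
  intros Hf Hg Hh.
  apply (total_comp (fun v => f (Vector.hd v) (Vector.hd (Vector.tl v)))
    (fun v => Vector.cons _ (g v) _ (Vector.cons _ (h v) _ (Vector.nil _)))); auto.
  intros i. apply (Fin.caseS' i); auto. intros j.
  apply (Fin.caseS' j); auto. intros l. now apply Fin.case0.
Qed.

Lemma total_const {n} c : total_rec (fun _ : Vector.t nat n => c).
Proof.
  induction c; [apply total_zero |]. now apply (total_comp1 S); [apply rec1_S |].
Qed.

Lemma total_prec {n} (f : Vector.t nat n -> nat) (g : Vector.t nat (S (S n)) -> nat) :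
  total_rec f -> total_rec g ->
  total_rec (fun v => nat_rect (fun _ => nat) (f (Vector.tl v))
    (fun k z => g (Vector.cons _ k _ (Vector.cons _ z _ (Vector.tl v)))) (Vector.hd v)).
Proof.
  intros [rf Hf] [rg Hg]. exists (RPrec rf rg). intros v. cbn.
  induction (Vector.hd v) as [| k IH]; cbn; intros y; [apply Hf |].
  split.
  - intros (z & Hz & Hy). apply IH in Hz. apply Hg in Hy. now subst.
  - intros ->. eexists. split; [now apply IH | now apply Hg].
Qed.

Lemma rec1_prec (c : nat) (g : nat -> nat -> nat) :
  rec2 g -> rec1 (nat_rect (fun _ => nat) c g).
Proof.
  intros Hg.
  apply (total_prec (n := 0) (fun _ => c) (fun v => g (Vector.hd v) (Vector.hd (Vector.tl v))));
    auto using total_const.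
Qed.

Lemma rec2_prec (f : nat -> nat) (g : nat -> nat -> nat -> nat) :
  rec1 f ->
  total_rec (fun v : Vector.t nat 3 =>
    g (Vector.hd v) (Vector.hd (Vector.tl v)) (Vector.hd (Vector.tl (Vector.tl v)))) ->
  rec2 (fun k x => nat_rect (fun _ => nat) (f x) (fun k z => g k z x) k).
Proof. intros Hf Hg. apply (total_prec (n := 1) _ _ Hf Hg). Qed.

Lemma rec2_flip f : rec2 f -> rec2 (fun x y => f y x).
Proof.
  intros Hf. apply (total_comp2 f); auto using total_fst, total_snd.
Qed.

Lemma rec2_iter f : rec1 f -> rec2 (fun n x => Nat.iter n f x).
Proof.
  intros Hf.
  apply (total_ext (fun v => nat_rect (fun _ => nat) (Vector.hd (Vector.tl v))
    (fun k z => f z) (Vector.hd v))); [reflexivity |].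
  apply (rec2_prec (fun x => x) (fun _ z _ => f z)); [apply total_fst |].
  apply total_comp1; auto using total_snd.
Qed.

Lemma rec1_const c : rec1 (fun _ => c).
Proof. exact (total_const c). Qed.

Lemma rec1_id : rec1 (fun x => x).
Proof. apply total_fst. Qed.

Lemma rec1_comp f g : rec1 f -> rec1 g -> rec1 (fun x => f (g x)).
Proof. intros Hf Hg. exact (total_comp1 f _ Hf Hg). Qed.

Lemma rec1_comp2 f g h : rec2 f -> rec1 g -> rec1 h -> rec1 (fun x => f (g x) (h x)).
Proof. intros Hf Hg Hh. exact (total_comp2 f _ _ Hf Hg Hh). Qed.

Lemma rec2_add : rec2 Nat.add.
Proof.
  apply (total_ext (fun v => Nat.iter (Vector.hd v) S (Vector.hd (Vector.tl v)))).
  - intros v. induction (Vector.hd v) as [| k IH]; cbn in *; auto.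
  - apply (rec2_iter S), rec1_S.
Qed.

Lemma rec1_pred : rec1 Nat.pred.
Proof.
  apply (rec1_ext (nat_rect (fun _ => nat) 0 (fun k _ => k))).
  - now intros [].
  - apply rec1_prec, total_fst.
Qed.

Lemma rec2_sub : rec2 Nat.sub.
Proof.
  apply (total_ext (fun v => Nat.iter (Vector.hd (Vector.tl v)) Nat.pred (Vector.hd v))).
  - intros v. generalize (Vector.hd v) as n, (Vector.hd (Vector.tl v)) as k.
    induction k as [| k IH]; [symmetry; apply Nat.sub_0_r |].
    now rewrite Nat.iter_succ, IH, Nat.sub_succ_r.
  - apply (rec2_flip (fun n x => Nat.iter n Nat.pred x)), rec2_iter, rec1_pred.
Qed.

Definition if0 (c a b : nat) : nat := match c with 0 => a | S _ => b end.

Lemma rec1_if0 f g h :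
  rec1 f -> rec1 g -> rec1 h -> rec1 (fun x => if0 (f x) (g x) (h x)).
Proof.
  intros Hf Hg Hh.
  apply (rec1_ext (fun x => nat_rect (fun _ => nat) (g x) (fun _ _ => h x) (f x))).
  { intros x. now destruct (f x). }
  apply (rec1_comp2 (fun n x => nat_rect (fun _ => nat) (g x) (fun _ _ => h x) n) f
           (fun x => x)); auto using rec1_id.
  apply (rec2_prec g (fun _ _ x => h x)); auto.
  apply (total_comp1 h); auto.
  apply (total_ext (fun v : Vector.t nat 3 => Vector.nth v (Fin.FS (Fin.FS Fin.F1))));
    [| apply total_proj].
  intros v; apply (Vector.caseS' v); intros x w; apply (Vector.caseS' w);
    intros y u; apply (Vector.caseS' u); reflexivity.
Qed.

Lemma rec1_eqb f g h k :
  rec1 f -> rec1 g -> rec1 h -> rec1 k ->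
  rec1 (fun x => if f x =? g x then h x else k x).
Proof.
  intros Hf Hg Hh Hk.
  (* The sum of the two truncated differences vanishes exactly on equality. *)
  apply (rec1_ext (fun x => if0 ((f x - g x) + (g x - f x)) (h x) (k x))).
  - intros x. destruct (Nat.eqb_spec (f x) (g x)) as [-> | Hn].
    + now rewrite Nat.sub_diag.
    + destruct (f x - g x + (g x - f x)) eqn:E; [lia | reflexivity].
  - apply rec1_if0; auto using rec1_comp2, rec2_add, rec2_sub.
Qed.

(** * Pairing *)

Definition pfst (n : nat) : nat := fst (Cantor.of_nat n).
Definition psnd (n : nat) : nat := snd (Cantor.of_nat n).

Lemma pfst_pair a b : pfst (cpair a b) = a.
Proof. unfold pfst, cpair. now rewrite Cantor.cancel_of_to. Qed.

Lemma psnd_pair a b : psnd (cpair a b) = b.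
Proof. unfold psnd, cpair. now rewrite Cantor.cancel_of_to. Qed.

Lemma pair_eta n : cpair (pfst n) (psnd n) = n.
Proof.
  unfold cpair, pfst, psnd. rewrite <- surjective_pairing. apply Cantor.cancel_to_of.
Qed.

(** Triangular numbers, in the form in which [Cantor.to_nat] computes them, so that [cpair_tri]
    holds by conversion. *)
Definition tri : nat -> nat := nat_rect (fun _ => nat) 0 (fun i m => S i + m).

Lemma cpair_tri a b : cpair a b = b + tri (b + a).
Proof. reflexivity. Qed.

(* The diagonal on which the pair with code [n] lies. *)
Definition diag : nat -> nat :=
  nat_rect (fun _ => nat) 0 (fun n t => if n - tri t =? t then S t else t).

(** Successive codes walk along a diagonal with rising second component. The walk moves to the next
    diagonal after the pair with first component 0, which is where the second component equals the
    diagonal's number. *)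
Lemma diag_spec n : diag n = psnd n + pfst n.
Proof.
  induction n as [| n IH]; [reflexivity |].
  change (diag (S n)) with (if n - tri (diag n) =? diag n then S (diag n) else diag n).
  rewrite IH.
  assert (E : n - tri (psnd n + pfst n) = psnd n).
  { rewrite <- (pair_eta n) at 1. rewrite cpair_tri. lia. }
  rewrite E.
  assert (Ho : Cantor.of_nat (S n) =
            match pfst n with
            | 0 => (S (psnd n), 0) | S x => (x, S (psnd n)) end).
  { unfold pfst, psnd.
    change (Cantor.of_nat (S n)) with
      (let (x, y) := Cantor.of_nat n in
       match x with 0 => (S y, 0) | S x => (x, S y) end).
    now destruct (Cantor.of_nat n) as [[] ?]. }
  assert (Hs : psnd (S n) + pfst (S n) =
            match pfst n with 0 => S (psnd n) | S x => S (psnd n) + x end).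
  { unfold pfst at 1, psnd at 1. rewrite Ho. destruct (pfst n); cbn; lia. }
  rewrite Hs. destruct (Nat.eqb_spec (psnd n) (psnd n + pfst n));
    destruct (pfst n); lia.
Qed.

Ltac total :=
  repeat first
    [ apply total_zero | apply total_fst | apply total_snd
    | apply rec2_add | apply rec2_sub | apply rec1_S | assumption
    | apply (total_comp2 Nat.add) | apply (total_comp2 Nat.sub)
    | apply (total_comp1 tri) | apply (total_comp1 S) ].

Lemma rec1_tri : rec1 tri.
Proof. apply rec1_prec. total. Qed.

Lemma rec2_pair : rec2 cpair.
Proof.
  pose proof rec1_tri.
  apply (total_ext (fun v =>
    Vector.hd (Vector.tl v) + tri (Vector.hd (Vector.tl v) + Vector.hd v)));
    [reflexivity | total].
Qed.

Lemma rec1_diag : rec1 diag.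
Proof.
  pose proof rec1_tri. apply rec1_prec.
  (* Branch-free form of the recursion: [1 - d] is 1 exactly when [d = 0], and here [d] is the sum
     of both truncated differences. *)
  apply (total_ext (fun v : Vector.t nat 2 =>
    let n := Vector.hd v in let t := Vector.hd (Vector.tl v) in
    t + (1 - ((n - tri t - t) + (t - (n - tri t))))));
    [| cbn zeta; total].
  intros v; cbn zeta.
  destruct (Nat.eqb_spec (Vector.hd v - tri (Vector.hd (Vector.tl v)))
    (Vector.hd (Vector.tl v))); lia.
Qed.

Lemma rec1_psnd : rec1 psnd.
Proof.
  apply (rec1_ext (fun n => n - tri (diag n))).
  - intros n. rewrite diag_spec. rewrite <- (pair_eta n) at 1. rewrite cpair_tri. lia.
  - auto using rec1_comp2, rec2_sub, rec1_comp, rec1_tri, rec1_diag, rec1_id.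
Qed.

Lemma rec1_pfst : rec1 pfst.
Proof.
  apply (rec1_ext (fun n => diag n - psnd n)).
  - intros n. rewrite diag_spec. lia.
  - auto using rec1_comp2, rec2_sub, rec1_diag, rec1_psnd.
Qed.

(** * Recursive enumerability *)

(** As [f] is total, minimization meets no undefined value and halts exactly when a zero exists. *)
Lemma re_projection (f : nat -> nat) (A : nat -> Prop) :
  rec1 f -> (forall m, A m <-> exists y, f (cpair y m) = 0) ->
  recursively_enumerable A.
Proof.
  intros Hf HA.
  assert (H : rec2 (fun y m => f (cpair y m))).
  { apply total_comp1; auto. apply rec2_pair. }
  destruct H as [rf H]. exists (RMu rf). intros m. rewrite HA. split.
  - intros (y0 & Hy0).
    destruct (dec_inh_nat_subset_has_unique_least_element (fun y => f (cpair y m) = 0))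
      as (y & [Hy Hmin] & _); [intros n; lia | now exists y0 |].
    exists y. cbn. split; [apply H; now cbn |].
    (* Minimization wants the earlier values in the form [S u]; they are nonzero by leastness of
       [y]. *)
    intros z Hz. exists (pred (f (cpair z m))). apply H. cbn.
    destruct (f (cpair z m)) eqn:E; auto. apply Hmin in E. lia.
  - intros (y & Hy & _). exists y. apply H in Hy. now symmetry in Hy.
Qed.

(** * Horn clause programs *)

Inductive term : Set :=
| Var (i : nat)
| Num (n : nat)
| Suc (t : term)
| Pair (t u : term).

Definition clause : Set := term * list term.

(* A number is read as the infinite sequence of its iterated projections, so
   that every number is a valuation. *)
Definition lookup (l i : nat) : nat := pfst (Nat.iter i psnd l).

Fixpoint teval (l : nat) (t : term) : nat :=
  match t with
  | Var i => lookup l i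
  | Num n => n
  | Suc t => S (teval l t)
  | Pair t u => cpair (teval l t) (teval l u)
  end.

Inductive derives (P : list clause) : nat -> Prop :=
| derives_clause h b l :
    In (h, b) P -> (forall t, In t b -> derives P (teval l t)) ->
    derives P (teval l h).

Definition push (l : nat) (b : list term) (s : nat) : nat :=
  fold_right (fun t s => S (cpair (teval l t) s)) s b.

(* The stack of open goals is [0] or [S (cpair goal stack)]; the choice [c]
   names the clause to use and its valuation. *)
Fixpoint resolve (P : list clause) (i c s : nat) : nat :=
  match P with
  | [] => s
  | (h, b) :: P =>
      if cpair i s =? cpair (pfst c) (S (cpair (teval (psnd c) h) (psnd (pred s))))
      then push (psnd c) b (psnd (pred s))
      else resolve P (S i) c s
  end.

(** A state pairs the goal stack with an oracle, read as an infinite stream of choices; each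
    transition consumes one choice. *)
Definition transition (P : list clause) (x : nat) : nat :=
  cpair (resolve P 0 (pfst (psnd x)) (pfst x)) (psnd (psnd x)).

(** * Recursiveness of the search *)

Lemma rec1_pair f g : rec1 f -> rec1 g -> rec1 (fun x => cpair (f x) (g x)).
Proof. apply rec1_comp2, rec2_pair. Qed.

Lemma rec1_S_comp f : rec1 f -> rec1 (fun x => S (f x)).
Proof. apply rec1_comp, rec1_S. Qed.

Lemma rec1_pred_comp f : rec1 f -> rec1 (fun x => pred (f x)).
Proof. apply rec1_comp, rec1_pred. Qed.

Lemma rec1_pfst_comp f : rec1 f -> rec1 (fun x => pfst (f x)).
Proof. apply rec1_comp, rec1_pfst. Qed.

Lemma rec1_psnd_comp f : rec1 f -> rec1 (fun x => psnd (f x)).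
Proof. apply rec1_comp, rec1_psnd. Qed.

#[local] Hint Resolve rec1_id rec1_const rec1_pair rec1_S_comp rec1_pred_comp
  rec1_pfst_comp rec1_psnd_comp : rec.

Lemma rec1_teval l t : rec1 l -> rec1 (fun x => teval (l x) t).
Proof.
  intros Hl. induction t as [i | | |]; cbn; auto with rec.
  apply rec1_pfst_comp. induction i; cbn; auto with rec.
Qed.

Lemma rec1_push l b s : rec1 l -> rec1 s -> rec1 (fun x => push (l x) b (s x)).
Proof.
  intros Hl Hs. induction b; cbn; auto with rec.
  apply rec1_S_comp, rec1_pair; auto. now apply rec1_teval.
Qed.

Lemma rec1_resolve P i c s :
  rec1 c -> rec1 s -> rec1 (fun x => resolve P i (c x) (s x)).
Proof.
  intros Hc Hs. revert i. induction P as [| [h b] P IH]; intros i; cbn; auto.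
  apply rec1_eqb; auto using rec1_push with rec.
  apply rec1_pair; auto with rec. apply rec1_S_comp, rec1_pair; auto with rec.
  apply rec1_teval; auto with rec.
Qed.

Lemma rec1_transition P : rec1 (transition P).
Proof. apply rec1_pair; auto with rec. apply rec1_resolve; auto with rec. Qed.

(** * Correctness of the search *)

Inductive all_derive (P : list clause) : nat -> Prop :=
| all_derive_nil : all_derive P 0
| all_derive_cons g s :
    derives P g -> all_derive P s -> all_derive P (S (cpair g s)).

Lemma all_derive_inv P g s :
  all_derive P (S (cpair g s)) -> derives P g /\ all_derive P s.
Proof.
  intros H. remember (S (cpair g s)) as n eqn:E.
  destruct H as [| g' s' Hg Hs]; [discriminate |].
  injection E as E. apply cpair_inj in E as [-> ->]. auto.
Qed.

Lemma all_derive_push P l b s :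
  all_derive P (push l b s) ->
  (forall t, In t b -> derives P (teval l t)) /\ all_derive P s.
Proof.
  induction b as [| t b IH]; cbn; intros H; [now split |].
  apply all_derive_inv in H as [Ht H]. apply IH in H as [Hb H].
  split; auto. intros u [<- | Hu]; auto.
Qed.

(** A fitting choice replaces a goal by premises that imply it, and any other choice leaves the
    stack unchanged, so derivability travels backwards along a run. *)
Lemma resolve_sound P P' i c s :
  incl P' P -> all_derive P (resolve P' i c s) -> all_derive P s.
Proof.
  revert i. induction P' as [| [h b] P' IH]; cbn; intros i Hincl H; auto.
  apply incl_cons_inv in Hincl as [Hh Hincl].
  destruct (Nat.eqb_spec (cpair i s)
    (cpair (pfst c) (S (cpair (teval (psnd c) h) (psnd (pred s)))))) as [E |];
    [| eauto].
  apply cpair_inj in E as [_ E]. rewrite E.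
  apply all_derive_push in H as [Hb Hs].
  constructor; auto. econstructor; eauto.
Qed.

Lemma resolve_complete P i j l h b s :
  nth_error P j = Some (h, b) ->
  resolve P i (cpair (i + j) l) (S (cpair (teval l h) s)) = push l b s.
Proof.
  revert i j. induction P as [| [h' b'] P IH]; intros i [| j] H; try discriminate;
    cbn [resolve pred]; rewrite ?pfst_pair, ?psnd_pair.
  - injection H as -> ->. now rewrite Nat.add_0_r, Nat.eqb_refl.
  - destruct (Nat.eqb_spec (cpair i (S (cpair (teval l h) s)))
      (cpair (i + S j) (S (cpair (teval l h') s)))) as [E | _].
    + apply cpair_inj in E as [E _]; lia.
    + rewrite <- Nat.add_succ_comm. now apply IH.
Qed.

(** Stating it for every remaining stack [s] and remaining oracle [o] lets the runs for the premises
    of a clause be concatenated. *)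
Lemma run_complete P g :
  derives P g ->
  forall s o, exists n o',
    Nat.iter n (transition P) (cpair (S (cpair g s)) o') = cpair s o.
Proof.
  induction 1 as [h b l Hin _ IH]; intros s o.
  (* The oracle is built back to front: the choices for the later premises form the remainder left
     over by the run for the first one. *)
  assert (Hb : exists n o',
    Nat.iter n (transition P) (cpair (push l b s) o') = cpair s o).
  { clear Hin. induction b as [| t b IHb]; [now exists 0, o |].
    destruct IHb as (n & o1 & Hn); [intros u Hu; apply IH; now right |].
    destruct (IH t (or_introl eq_refl) (push l b s) o1) as (n' & o' & Hn').
    exists (n + n'), o'. now rewrite Nat.iter_add, <- Hn, <- Hn'. }
  destruct Hb as (n & o' & Hn).
  apply In_nth_error in Hin as [j Hj].
  exists (S n), (cpair (cpair j l) o').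
  rewrite Nat.iter_succ_r, <- Hn. f_equal.
  unfold transition. rewrite !psnd_pair, !pfst_pair.
  f_equal. now apply (resolve_complete P 0).
Qed.

Lemma run_sound P n x : pfst (Nat.iter n (transition P) x) = 0 -> all_derive P (pfst x).
Proof.
  revert x. induction n as [| n IH]; intros x H; [cbn in H; rewrite H; constructor |].
  rewrite Nat.iter_succ_r in H. apply IH in H. unfold transition in H.
  rewrite pfst_pair in H. now apply resolve_sound in H.
Qed.

(** The searched number codes a step count and an oracle; that the run they determine empties the
    stack is a total recursive test. *)
Theorem derives_re P goal :
  rec1 goal -> recursively_enumerable (fun m => derives P (goal m)).
Proof.
  intros Hg.
  apply (re_projection (fun x =>
    pfst (Nat.iter (pfst (pfst x)) (transition P)
      (cpair (S (cpair (goal (psnd x)) 0)) (psnd (pfst x)))))).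
  - apply rec1_pfst_comp.
    apply (rec1_comp2 (fun n x => Nat.iter n (transition P) x));
      auto using rec2_iter, rec1_transition with rec.
    apply rec1_pair; auto with rec. apply rec1_S_comp, rec1_pair; auto with rec.
    apply rec1_comp; auto with rec.
  - intros m. split.
    + intros H. destruct (run_complete P _ H 0 0) as (n & o & Hn).
      exists (cpair n o). now rewrite !pfst_pair, !psnd_pair, Hn, pfst_pair.
    + intros [y Hy]. apply run_sound in Hy.
      rewrite psnd_pair, pfst_pair in Hy. now apply all_derive_inv in Hy.
Qed.

(** * The clauses of the language *)

#[local] Arguments code_expr : simpl never.
#[local] Arguments code_ty : simpl never.
#[local] Arguments code_op : simpl never.
#[local] Arguments code_pat : simpl never.
#[local] Arguments code_bool : simpl never.

(** * Finite valuations and the meaning of facts *)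

Fixpoint tval (xs : list nat) (t : term) : nat :=
  match t with
  | Var i => nth i xs 0
  | Num n => n
  | Suc t => S (tval xs t)
  | Pair t u => cpair (tval xs t) (tval xs u)
  end.

Lemma teval_tval xs t : teval (fold_right cpair 0 xs) t = tval xs t.
Proof.
  induction t as [i | | |]; cbn; try congruence.
  unfold lookup. revert i.
  induction xs as [| x xs IH]; intros i.
  (* The code 0 stands for the pair of zeros, so reading past the end of the list gives 0, matching
     the default of [nth]. *)
  - cbn [fold_right]. replace (Nat.iter i psnd 0) with 0; [now destruct i |].
    induction i as [| i IH]; auto. now rewrite Nat.iter_succ, <- IH.
  - destruct i as [| i]; [apply pfst_pair |].
    rewrite Nat.iter_succ_r. cbn [fold_right]. rewrite psnd_pair. apply IH.
Qed.

Lemma derives_nth P n xs g :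
  match nth_error P n with
  | Some (h, b) => g = tval xs h /\ Forall (fun t => derives P (tval xs t)) b
  | None => False
  end -> derives P g.
Proof.
  destruct (nth_error P n) as [[h b] |] eqn:E; [| easy].
  intros [-> H]. rewrite <- teval_tval.
  apply derives_clause with b; [now apply nth_error_In in E |].
  intros t Ht. rewrite Forall_forall in H. rewrite teval_tval. auto.
Qed.

Fixpoint code_list (l : list nat) : nat :=
  match l with [] => 0 | x :: l => S (cpair x (code_list l)) end.

(** Invariant of the derivable facts, by tag. Where clauses may be instantiated with numbers that
    code nothing, the meaning is conditional on the inputs being codes; evaluation then supplies a
    decoded result. The scoping fact asserts outright that its second argument codes an
    expression. *)
Definition holds_of (k a b c d : nat) : Prop :=
  match k with
  | 0 => a <> b
  | 1 => forall v, code_expr v = a -> value v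
  | 2 => forall v p, code_expr v = a -> code_pat p = b -> code_bool (matches v p) = c
  | 3 => exists z, code_Z z = a /\ code_Z (z + 1) = b
  | 4 => exists y z, code_Z y = a /\ code_Z z = b /\ code_Z (y + z) = c
  | 5 => forall o v1 v2, code_op o = a -> code_expr v1 = b -> code_expr v2 = c ->
         code_expr (delta o v1 v2) = d
  | 6 => forall v e, code_expr v = b -> code_expr e = c -> code_expr (subst a v e) = d
  | 7 => forall e, code_expr e = a -> exists r, code_expr r = b /\ ev e r
  | 8 => forall l, code_list l = b -> In a l
  | 9 => forall l, code_list l = a ->
         exists e, code_expr e = b /\ forall x, free x e -> In x l
  | 10 => exists t, code_ty t = a /\
          forall e, code_expr e = b -> code_expr (chk t e) = c
  | 11 => exists t, code_ty t = a /\ code_expr (gen t) = b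
  | 12 => exists p, code p = a /\ closed (fst p) /\ ev (chk (snd p) (fst p)) EError
  | _ => True
  end.

Definition holds (n : nat) : Prop :=
  let a := psnd n in let b := psnd a in let c := psnd b in
  holds_of (pfst n) (pfst a) (pfst b) (pfst c) (psnd c).

Lemma holds_fact k a b c d :
  holds (cpair k (cpair a (cpair b (cpair c d)))) = holds_of k a b c d.
Proof. unfold holds. now rewrite !psnd_pair, !pfst_pair. Qed.

Definition Fact (k : nat) (a b c d : term) : term :=
  Pair (Num k) (Pair a (Pair b (Pair c d))).

#[local] Notation "$ i" := (Var i) (at level 0, i at level 0).

(* The tag of a fact selects its meaning in [holds_of]. *)
Definition Neq a b := Fact 0 a b (Num 0) (Num 0).
Definition Value a := Fact 1 a (Num 0) (Num 0) (Num 0).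
Definition Matches a b c := Fact 2 a b c (Num 0).
Definition Succ a b := Fact 3 a b (Num 0) (Num 0).
Definition Add a b c := Fact 4 a b c (Num 0).
Definition Delta a b c d := Fact 5 a b c d.
Definition Subst a b c d := Fact 6 a b c d.
Definition Ev a b := Fact 7 a b (Num 0) (Num 0).
Definition Mem a b := Fact 8 a b (Num 0) (Num 0).
Definition Scoped a b := Fact 9 a b (Num 0) (Num 0).
Definition Chk a b c := Fact 10 a b c (Num 0).
Definition Gen a b := Fact 11 a b (Num 0) (Num 0).
Definition Ill a := Fact 12 a (Num 0) (Num 0) (Num 0).

(** Term counterparts of the codes: the tags are those of [code_expr], and [Tag] alone also serves
    for the sign of an integer. *)
Definition Tag (k : nat) (t : term) : term := Pair (Num k) t.
Definition Tag2 k t u := Tag k (Pair t u).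
Definition Tag3 k t u v := Tag k (Pair t (Pair u v)).

Definition TInt' := Tag 0.
Definition TBool' := Tag 1.
Definition TFun' := Tag2 2.
Definition TVar' := Tag 3.
Definition TApp' := Tag2 4.
Definition TOp' := Tag3 5.
Definition TIf' := Tag3 6.
Definition TTest' := Tag2 7.
Definition Const (e : expr) := Num (code_expr e).
Definition Bool (b : bool) := Num (code_bool b).
Definition Op (o : op) := Num (code_op o).
Definition Pat (p : pat) := Num (code_pat p).
Definition Cons t u := Suc (Pair t u).

Definition ops := [OAdd; OSub; OLt; OEq; OAnd; OOr; OXor].
Definition pats := [PInt; PBool; PFun].
Definition bools := [true; false].

Definition basic_clauses : list clause :=
  [ (Neq (Num 0) (Suc $0), []);
    (Neq (Suc $0) (Num 0), []);
    (Neq (Suc $0) (Suc $1), [Neq $0 $1]);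
    (Value (TInt' $0), []);
    (Value (TBool' $0), []);
    (Value (TFun' $0 $1), []);
    (Mem $0 (Cons $0 $1), []);
    (Mem $0 (Cons $1 $2), [Mem $0 $2]) ] ++
  flat_map (fun p =>
    [ (Matches (TInt' $0) (Pat p) (Bool (matches (EInt 0) p)), []);
      (Matches (TBool' $0) (Pat p) (Bool (matches (EBool true) p)), []);
      (Matches (TFun' $0 $1) (Pat p) (Bool (matches (EFun 0 EError) p)), []) ]) pats.

(** Integers are sign and magnitude, and [Tag 1 (Suc _)] rules out a negative zero. Addition
    recurses on the second summand in both directions from zero. *)
Definition arith_clauses : list clause :=
  [ (Succ (Tag 0 $0) (Tag 0 (Suc $0)), []);
    (Succ (Tag 1 (Suc (Suc $0))) (Tag 1 (Suc $0)), []);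
    (Succ (Tag 1 (Num 1)) (Tag 0 (Num 0)), []);
    (Add (Tag 0 $0) (Tag 0 (Num 0)) (Tag 0 $0), []);
    (Add (Tag 1 (Suc $0)) (Tag 0 (Num 0)) (Tag 1 (Suc $0)), []);
    (Add $0 $2 $4, [Add $0 $1 $3; Succ $1 $2; Succ $3 $4]);
    (Add $0 $2 $4, [Add $0 $1 $3; Succ $2 $1; Succ $4 $3]) ].

(** Subtraction is addition read backwards, and comparisons are witnessed by a difference: of the
    form [Suc] when strict, any natural number otherwise. *)
Definition delta_clauses : list clause :=
  [ (Delta (Op OAdd) (TInt' $0) (TInt' $1) (TInt' $2), [Add $0 $1 $2]);
    (Delta (Op OSub) (TInt' $0) (TInt' $1) (TInt' $2), [Add $2 $1 $0]);
    (Delta (Op OLt) (TInt' $0) (TInt' $1) (Const (EBool true)),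
       [Add $0 (Tag 0 (Suc $2)) $1]);
    (Delta (Op OLt) (TInt' $0) (TInt' $1) (Const (EBool false)),
       [Add $1 (Tag 0 $2) $0]);
    (Delta (Op OEq) (TInt' $0) (TInt' $0) (Const (EBool true)), []);
    (Delta (Op OEq) (TInt' $0) (TInt' $1) (Const (EBool false)),
       [Add $0 (Tag 0 (Suc $2)) $1]);
    (Delta (Op OEq) (TInt' $0) (TInt' $1) (Const (EBool false)),
       [Add $1 (Tag 0 (Suc $2)) $0]) ] ++
  flat_map (fun o => flat_map (fun a => map (fun b =>
    (Delta (Op o) (Const (EBool a)) (Const (EBool b))
       (Const (delta o (EBool a) (EBool b))), [])) bools) bools) [OAnd; OOr; OXor] ++
  flat_map (fun o =>
    let p := Pat (match o with OAnd | OOr | OXor => PBool | _ => PInt end) in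
    [ (Delta (Op o) $0 $1 (Const EError), [Matches $0 p (Bool false)]);
      (Delta (Op o) $0 $1 (Const EError), [Matches $1 p (Bool false)]) ]) ops.

Definition subst_clauses : list clause :=
  map (fun k => (Subst $0 $1 (Tag k $2) (Tag k $2), [])) [0; 1; 8; 9; 10] ++
  [ (Subst $0 $1 (TVar' $0) $1, []);
    (Subst $0 $1 (TVar' $2) (TVar' $2), [Neq $0 $2]);
    (Subst $0 $1 (TFun' $0 $2) (TFun' $0 $2), []);
    (Subst $0 $1 (TFun' $2 $3) (TFun' $2 $4), [Neq $0 $2; Subst $0 $1 $3 $4]);
    (Subst $0 $1 (TApp' $2 $3) (TApp' $4 $5),
       [Subst $0 $1 $2 $4; Subst $0 $1 $3 $5]);
    (Subst $0 $1 (TOp' $2 $3 $4) (TOp' $2 $5 $6),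
       [Subst $0 $1 $3 $5; Subst $0 $1 $4 $6]);
    (Subst $0 $1 (TIf' $2 $3 $4) (TIf' $5 $6 $7),
       [Subst $0 $1 $2 $5; Subst $0 $1 $3 $6; Subst $0 $1 $4 $7]);
    (Subst $0 $1 (TTest' $2 $3) (TTest' $4 $3), [Subst $0 $1 $2 $4]) ].

Definition ev_clauses : list clause :=
  let err := Const EError in
  [ (Ev $0 $0, [Value $0]);
    (Ev err err, []);
    (Ev (TApp' $0 $1) $6,
       [Ev $0 (TFun' $2 $3); Ev $1 $4; Value $4; Subst $2 $4 $3 $5; Ev $5 $6]);
    (Ev (TApp' $0 $1) err,
       [Ev $0 $2; Value $2; Matches $2 (Pat PFun) (Bool false); Ev $1 $3; Value $3]);
    (Ev (TApp' $0 $1) err, [Ev $0 err]);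
    (Ev (TApp' $0 $1) err, [Ev $1 err]);
    (Ev (TOp' $0 $1 $2) $5,
       [Ev $1 $3; Value $3; Ev $2 $4; Value $4; Delta $0 $3 $4 $5]);
    (Ev (TOp' $0 $1 $2) err, [Ev $1 err]);
    (Ev (TOp' $0 $1 $2) err, [Ev $1 $3; Value $3; Ev $2 err]);
    (Ev (TIf' $0 $1 $2) $3, [Ev $0 (Const (EBool true)); Ev $1 $3]);
    (Ev (TIf' $0 $1 $2) $3, [Ev $0 (Const (EBool false)); Ev $2 $3]);
    (Ev (TIf' $0 $1 $2) err,
       [Ev $0 $3; Value $3; Matches $3 (Pat PBool) (Bool false)]);
    (Ev (TIf' $0 $1 $2) err, [Ev $0 err]);
    (Ev (TTest' $0 $1) (TBool' $3), [Ev $0 $2; Value $2; Matches $2 $1 $3]);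
    (Ev (TTest' $0 $1) err, [Ev $0 err]);
    (Ev (Const EPickI) (TInt' (Tag 0 $0)), []);
    (Ev (Const EPickI) (TInt' (Tag 1 (Suc $0))), []);
    (Ev (Const EPickB) (Const (EBool true)), []);
    (Ev (Const EPickB) (Const (EBool false)), []) ].

(** Operators, patterns and constants are listed one by one because these clauses must also certify
    that the number is the code of an expression. *)
Definition scoped_clauses : list clause :=
  [ (Scoped $0 (TInt' (Tag 0 $1)), []);
    (Scoped $0 (TInt' (Tag 1 (Suc $1))), []);
    (Scoped $0 (TFun' $1 $2), [Scoped (Cons $1 $0) $2]);
    (Scoped $0 (TVar' $1), [Mem $1 $0]);
    (Scoped $0 (TApp' $1 $2), [Scoped $0 $1; Scoped $0 $2]);
    (Scoped $0 (TIf' $1 $2 $3), [Scoped $0 $1; Scoped $0 $2; Scoped $0 $3]) ] ++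
  map (fun o => (Scoped $0 (TOp' (Op o) $1 $2), [Scoped $0 $1; Scoped $0 $2])) ops ++
  map (fun p => (Scoped $0 (TTest' $1 (Pat p)), [Scoped $0 $1])) pats ++
  map (fun e => (Scoped $0 (Const e), []))
    [EBool true; EBool false; EPickI; EPickB; EError].

Definition chk_clauses : list clause :=
  [ (Chk (Num (code_ty TInt)) $0 (TOp' (Op OAdd) $0 (Const (EInt 0))), []);
    (Chk (Num (code_ty TBool)) $0 (TOp' (Op OAnd) $0 (Const (EBool true))), []);
    (Chk (Tag2 2 $0 $1) $2 $4, [Gen $0 $3; Chk $1 (TApp' $2 $3) $4]);
    (Gen (Num (code_ty TInt)) (Const EPickI), []);
    (Gen (Num (code_ty TBool)) (Const EPickB), []);
    (Gen (Tag2 2 $0 $1)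
       (TFun' (Num 0) (TIf' (Const EPickB) $2 (TApp' (TFun' (Num 0) $2) $3))),
       [Gen $1 $2; Chk $0 (Const (EVar 0)) $3]);
    (Ill (Pair $0 $1), [Scoped (Num 0) $0; Chk $1 $0 $2; Ev $2 (Const EError)]) ].

Definition program : list clause :=
  basic_clauses ++ arith_clauses ++ delta_clauses ++ subst_clauses ++
  ev_clauses ++ scoped_clauses ++ chk_clauses.

Lemma code_Z_nonneg n : code_Z (Z.of_nat n) = cpair 0 n.
Proof.
  unfold code_Z. destruct (Z.ltb_spec (Z.of_nat n) 0); [lia |].
  f_equal. lia.
Qed.

Lemma code_Z_neg n : code_Z (- Z.of_nat (S n)) = cpair 1 (S n).
Proof.
  unfold code_Z. destruct (Z.ltb_spec (- Z.of_nat (S n)) 0); [| lia].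
  f_equal. lia.
Qed.

Lemma Z_cases z : {n | z = Z.of_nat n} + {n | z = (- Z.of_nat (S n))%Z}.
Proof.
  destruct (Z_lt_le_dec z 0); [right; exists (pred (Z.abs_nat z)) | left; exists (Z.abs_nat z)];
    lia.
Qed.

(** * Soundness *)

Definition sound (c : clause) : Prop :=
  forall l, Forall (fun t => holds (teval l t)) (snd c) -> holds (teval l (fst c)).

Lemma derives_sound P n : Forall sound P -> derives P n -> holds n.
Proof.
  intros HP. induction 1 as [h b l Hin _ IH].
  rewrite Forall_forall in HP. apply (HP _ Hin). cbn.
  now apply Forall_forall.
Qed.

Lemma code_Z_nonneg_inv z n : code_Z z = cpair 0 n -> z = Z.of_nat n.
Proof. rewrite <- code_Z_nonneg. apply code_Z_inj. Qed.

Lemma code_Z_neg_inv z n : code_Z z = cpair 1 (S n) -> z = (- Z.of_nat (S n))%Z.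
Proof. rewrite <- code_Z_neg. apply code_Z_inj. Qed.

(** Recovers syntax from equations between codes and instantiates conditional facts at the syntax
    found. *)
Ltac decode :=
  repeat match goal with
  | H : code_expr ?e = cpair _ _ |- _ =>
      destruct e; unfold code_expr in H; fold code_expr in H; apply cpair_inj in H as [H ?];
      try discriminate H; clear H
  | H : code_ty ?t = cpair _ _ |- _ =>
      destruct t; unfold code_ty in H; fold code_ty in H; apply cpair_inj in H as [H ?];
      try discriminate H; clear H
  | H : cpair _ _ = cpair _ _ |- _ => apply cpair_inj in H as [? ?]
  | H : code_Z _ = cpair 0 _ |- _ => apply code_Z_nonneg_inv in H
  | H : code_Z _ = cpair 1 (S _) |- _ => apply code_Z_neg_inv in H
  | H : code_expr _ = code_expr _ |- _ => apply code_expr_inj in H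
  | H : code_Z _ = code_Z _ |- _ => apply code_Z_inj in H
  | H : code_op _ = code_op _ |- _ => apply code_op_inj in H
  | H : code_pat _ = code_pat _ |- _ => apply code_pat_inj in H
  | H : code_bool _ = code_bool _ |- _ => apply code_bool_inj in H
  | H : code_list ?l = S _ |- _ =>
      destruct l; cbn [code_list] in H; [discriminate H | injection H as H]
  | H : _ /\ _ |- _ => destruct H
  | H : exists _, _ |- _ => destruct H
  | H : forall e, code_expr e = code_expr _ -> _ |- _ => specialize (H _ eq_refl)
  | H : forall v e, code_expr v = code_expr _ -> code_expr e = code_expr _ -> _ |- _ =>
      specialize (H _ _ eq_refl eq_refl)
  | H : forall v p, code_expr v = code_expr _ -> code_pat p = code_pat _ -> _ |- _ =>
      specialize (H _ _ eq_refl eq_refl)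
  | H : forall o u v, code_op o = code_op _ -> code_expr u = code_expr _ ->
        code_expr v = code_expr _ -> _ |- _ =>
      specialize (H _ _ _ eq_refl eq_refl eq_refl)
  | _ => progress subst
  end.

Ltac open_clause :=
  let l := fresh "l" in let H := fresh "H" in
  intros l H;
  cbn [fst snd] in H |- *;
  repeat match goal with
  | H : Forall _ (_ :: _) |- _ => apply Forall_cons_iff in H as [? H]
  | H : Forall _ [] |- _ => clear H
  end;
  cbn -[holds lookup] in *;
  repeat match goal with
  | |- context [lookup l ?i] =>
      let y := fresh "y" in set (y := lookup l i) in *; clearbody y
  | H : context [lookup l ?i] |- _ =>
      let y := fresh "y" in set (y := lookup l i) in *; clearbody y
  end;
  rewrite ?holds_fact in *;
  cbn in *.

Ltac each_clause := repeat (apply Forall_cons; [open_clause |]); try apply Forall_nil.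

Lemma basic_sound : Forall sound basic_clauses.
Proof. cbn. each_clause; intros; decode; cbn; auto; lia. Qed.

Lemma arith_sound : Forall sound arith_clauses.
Proof.
  cbn. each_clause; decode.
  - exists (Z.of_nat y). rewrite <- !code_Z_nonneg. split; f_equal; lia.
  - exists (- Z.of_nat (S (S y)))%Z. rewrite <- !code_Z_neg. split; f_equal; lia.
  - exists (- 1)%Z. now split.
  - exists (Z.of_nat y), 0%Z. rewrite <- code_Z_nonneg. repeat split; f_equal; lia.
  - exists (- Z.of_nat (S y))%Z, 0%Z. rewrite <- code_Z_neg. repeat split; f_equal; lia.
  - exists x1, (x2 + 1)%Z. repeat split; f_equal; lia.
  - exists x1, x0. repeat split; f_equal; lia.
Qed.

Lemma delta_sound : Forall sound delta_clauses.
Proof.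
  cbn. each_clause; intros; decode; cbn [delta]; rewrite ?Z.add_simpl_r.
  all: repeat match goal with
    | |- context [(?a <? ?b)%Z] => destruct (Z.ltb_spec a b); try lia
    | |- context [(?a =? ?b)%Z] => destruct (Z.eqb_spec a b); try lia
    end; try reflexivity.
  all: destruct v1; try discriminate; try reflexivity;
    destruct v2; try discriminate; reflexivity.
Qed.

Lemma subst_sound : Forall sound subst_clauses.
Proof.
  cbn. each_clause; intros; decode; cbn [subst];
    rewrite ?Nat.eqb_refl; try reflexivity;
    repeat match goal with
    | |- context [Nat.eqb ?a ?b] => destruct (Nat.eqb_spec a b); try easy
    end.
Qed.

Lemma ev_sound : Forall sound ev_clauses.
Proof.
  cbn. each_clause; intros; decode.
  (* Results whose code is not literally a [code_expr] need an explicit witness; going downwards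
     keeps the goal numbers stable. *)
  17: exists (EInt (- Z.of_nat (S y))); rewrite <- code_Z_neg; split; [reflexivity | auto].
  16: exists (EInt (Z.of_nat y)); rewrite <- (code_Z_nonneg y); split; [reflexivity | auto].
  14: exists (EBool (matches x p)); split; [reflexivity | auto].
  all: eexists; split; [reflexivity | eauto].
  all: try (apply ev_if with true; now auto); apply ev_if with false; now auto.
Qed.

Lemma scoped_sound : Forall sound scoped_clauses.
Proof.
  cbn. each_clause; intros; decode.
  1: exists (EInt (Z.of_nat y0)); rewrite <- (code_Z_nonneg y0); now split.
  1: exists (EInt (- Z.of_nat (S y0))); rewrite <- code_Z_neg; now split.
  1: destruct (H0 (y0 :: l0) eq_refl) as (e & <- & He);
    exists (EFun y0 e); split; auto; cbn; intros z [Hz Hf];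
    destruct (He z Hf) as [<- |]; tauto.
  1: exists (EVar y0); split; auto; intros z ->; auto.
  all: repeat match goal with
     | H : forall l, code_list l = code_list _ -> _ |- _ =>
         destruct (H _ eq_refl) as (? & <- & ?); clear H
     end.
  all: match goal with
    | |- exists e, _ = cpair 4 (cpair (code_expr ?a) (code_expr ?b)) /\ _ =>
        exists (EApp a b)
    | |- exists e, _ = cpair 5 (cpair (code_op ?o) (cpair (code_expr ?a) (code_expr ?b)))
           /\ _ => exists (EOp o a b)
    | |- exists e, _ = cpair 6 (cpair (code_expr ?a) (cpair (code_expr ?b) (code_expr ?c)))
           /\ _ => exists (EIf a b c)
    | |- exists e, _ = cpair 7 (cpair (code_expr ?a) (code_pat ?p)) /\ _ =>
        exists (ETest a p)
    | |- exists e, _ = code_expr ?a /\ _ => exists a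
    end; split; [reflexivity | cbn; intros z Hz; intuition auto].
Qed.

Lemma chk_sound : Forall sound chk_clauses.
Proof.
  cbn. each_clause; intros; decode.
  - exists TInt. split; auto. now intros e <-.
  - exists TBool. split; auto. now intros e <-.
  - exists (TArr x0 x). split; auto. intros e <-. cbn [chk]. auto.
  - now exists TInt.
  - now exists TBool.
  - exists (TArr x x0). now split.
  (* The scope 0 codes the empty list, so the decoded expression is closed. *)
  - destruct (H0 [] eq_refl) as (e & He & Hc).
    decode. exists (e, x). repeat split; auto.
Qed.

Lemma program_sound n : derives program n -> holds n.
Proof.
  apply derives_sound. unfold program.
  rewrite !Forall_app. repeat split;
    auto using basic_sound, arith_sound, delta_sound, subst_sound, ev_sound,
      scoped_sound, chk_sound.
Qed.

(** * Completeness *)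

#[local] Opaque cpair.

(* Conversion would unfold [cpair] when the two sides differ, and compute with
   huge unary numbers. *)
Ltac same_code :=
  lazymatch goal with
  | |- ?a = ?b =>
      let a' := eval cbv -[cpair code_Z] in a in
      let b' := eval cbv -[cpair code_Z] in b in
      constr_eq a' b'; reflexivity
  end.

(** Searches for a clause whose head matches the goal when its variables take the values [xs] in
    order; the instantiated premises must be among the hypotheses. *)
Ltac by_clause xs :=
  let rec search n :=
    first
      [ apply (derives_nth program n xs); split;
        [ same_code
        | repeat (apply Forall_cons; [assumption |]); apply Forall_nil ]
      | lazymatch eval compute in (Nat.ltb n (length program)) with
        | true => search (S n)
        end ] in
  search 0.

Definition derivable k a b c d :=
  derives program (cpair k (cpair a (cpair b (cpair c d)))).

Lemma derivable_neq a b : a <> b -> derivable 0 a b 0 0.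
Proof.
  revert b; induction a as [| a IH]; intros [| b] H; try easy.
  - by_clause [b].
  - by_clause [a].
  - assert (derivable 0 a b 0 0) by (apply IH; lia). by_clause [a; b].
Qed.

Lemma derivable_value v : value v -> derivable 1 (code_expr v) 0 0 0.
Proof.
  destruct 1.
  - by_clause [code_Z n].
  - by_clause [code_bool b].
  - by_clause [x; code_expr e].
Qed.

Lemma derivable_matches v p :
  value v -> derivable 2 (code_expr v) (code_pat p) (code_bool (matches v p)) 0.
Proof.
  destruct 1, p.
  1-3: by_clause [code_Z n].
  1-3: by_clause [code_bool b].
  all: by_clause [x; code_expr e].
Qed.

Lemma derivable_succ z : derivable 3 (code_Z z) (code_Z (z + 1)) 0 0.
Proof.
  destruct (Z_cases z) as [[n ->] | [[| n] ->]].
  - replace (Z.of_nat n + 1)%Z with (Z.of_nat (S n)) by lia.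
    rewrite !code_Z_nonneg. by_clause [n].
  - replace (- Z.of_nat 1 + 1)%Z with (Z.of_nat 0) by lia.
    rewrite code_Z_neg, code_Z_nonneg. by_clause (@nil nat).
  - replace (- Z.of_nat (S (S n)) + 1)%Z with (- Z.of_nat (S n))%Z by lia.
    rewrite !code_Z_neg. by_clause [n].
Qed.

Lemma derivable_add y z : derivable 4 (code_Z y) (code_Z z) (code_Z (y + z)) 0.
Proof.
  induction z as [| z IH | z IH] using Z.peano_ind.
  - change (code_Z 0) with (cpair 0 0). rewrite Z.add_0_r. destruct (Z_cases y) as [[n ->] | [n ->]].
    + rewrite code_Z_nonneg. by_clause [n].
    + rewrite code_Z_neg. by_clause [n].
  - pose proof (derivable_succ z). pose proof (derivable_succ (y + z)).
    replace (y + Z.succ z)%Z with (y + z + 1)%Z by lia.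
    by_clause [code_Z y; code_Z z; code_Z (Z.succ z); code_Z (y + z);
      code_Z (y + z + 1)].
  - pose proof (derivable_succ (Z.pred z)) as H1.
    pose proof (derivable_succ (y + Z.pred z)) as H2.
    replace (Z.pred z + 1)%Z with z in H1 by lia.
    replace (y + Z.pred z + 1)%Z with (y + z)%Z in H2 by lia.
    by_clause [code_Z y; code_Z z; code_Z (Z.pred z); code_Z (y + z);
      code_Z (y + Z.pred z)].
Qed.

Lemma derivable_add_nonneg y z n :
  (z = y + Z.of_nat n)%Z -> derivable 4 (code_Z y) (cpair 0 n) (code_Z z) 0.
Proof. intros ->. rewrite <- code_Z_nonneg. apply derivable_add. Qed.

Lemma derivable_delta o v1 v2 :
  value v1 -> value v2 ->
  derivable 5 (code_op o) (code_expr v1) (code_expr v2) (code_expr (delta o v1 v2)).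
Proof.
  intros H1 H2.
  (* All operator type errors at once: [p] is the operand kind that [o] expects, and one operand
     failing it suffices. *)
  assert (Herr : forall p, p = match o with OAnd | OOr | OXor => PBool | _ => PInt end ->
    matches v1 p = false \/ matches v2 p = false ->
    derivable 5 (code_op o) (code_expr v1) (code_expr v2) (code_expr EError)).
  { intros p -> [E | E];
      [pose proof (derivable_matches v1) as Hd | pose proof (derivable_matches v2) as Hd];
      match type of E with matches _ ?p = _ => specialize (Hd p) end;
      rewrite E in Hd; specialize (Hd ltac:(assumption)); destruct o;
      by_clause [code_expr v1; code_expr v2]. }
  destruct H1 as [m | a | x e], H2 as [n | b | y e'].
  all: try (destruct o; cbn [delta]; apply (Herr _ eq_refl); cbn; now auto).
  - destruct o; cbn [delta]; try (apply (Herr _ eq_refl); cbn; now auto).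
    + pose proof (derivable_add m n).
      by_clause [code_Z m; code_Z n; code_Z (m + n)].
    + pose proof (derivable_add (m - n) n). rewrite Z.sub_add in H.
      by_clause [code_Z m; code_Z n; code_Z (m - n)].
    + destruct (Z.ltb_spec m n).
      (* The strict clause wants a difference [S k], whence [k = n - m - 1]. *)
      * pose proof (derivable_add_nonneg m n (S (Z.abs_nat (n - m - 1))) ltac:(lia)).
        by_clause [code_Z m; code_Z n; Z.abs_nat (n - m - 1)].
      * pose proof (derivable_add_nonneg n m (Z.abs_nat (m - n)) ltac:(lia)).
        by_clause [code_Z m; code_Z n; Z.abs_nat (m - n)].
    + destruct (Z.eqb_spec m n) as [-> | Hn]; [by_clause [code_Z n] |].
      destruct (Z_lt_le_dec m n).
      * pose proof (derivable_add_nonneg m n (S (Z.abs_nat (n - m - 1))) ltac:(lia)).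
        by_clause [code_Z m; code_Z n; Z.abs_nat (n - m - 1)].
      * pose proof (derivable_add_nonneg n m (S (Z.abs_nat (m - n - 1))) ltac:(lia)).
        by_clause [code_Z m; code_Z n; Z.abs_nat (m - n - 1)].
  - destruct o; try (apply (Herr _ eq_refl); cbn; now auto); destruct a, b;
      by_clause (@nil nat).
Qed.

Lemma derivable_subst x v e :
  derivable 6 x (code_expr v) (code_expr e) (code_expr (subst x v e)).
Proof.
  induction e as [n | b | y e IH | y | e1 IH1 e2 IH2 | o e1 IH1 e2 IH2
    | e0 IH0 e1 IH1 e2 IH2 | e IH p | | |]; cbn [subst].
  - by_clause [x; code_expr v; code_Z n].
  - by_clause [x; code_expr v; code_bool b].
  - destruct (Nat.eqb_spec x y) as [<- | Hn].
    + by_clause [x; code_expr v; code_expr e].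
    + apply derivable_neq in Hn.
      by_clause [x; code_expr v; y; code_expr e; code_expr (subst x v e)].
  - destruct (Nat.eqb_spec x y) as [<- | Hn].
    + by_clause [x; code_expr v].
    + apply derivable_neq in Hn. by_clause [x; code_expr v; y].
  - by_clause [x; code_expr v; code_expr e1; code_expr e2;
      code_expr (subst x v e1); code_expr (subst x v e2)].
  - by_clause [x; code_expr v; code_op o; code_expr e1; code_expr e2;
      code_expr (subst x v e1); code_expr (subst x v e2)].
  - by_clause [x; code_expr v; code_expr e0; code_expr e1; code_expr e2;
      code_expr (subst x v e0); code_expr (subst x v e1); code_expr (subst x v e2)].
  - by_clause [x; code_expr v; code_expr e; code_pat p; code_expr (subst x v e)].
  - by_clause [x; code_expr v; 0].
  - by_clause [x; code_expr v; 0].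
  - by_clause [x; code_expr v; 0].
Qed.

Lemma derivable_ev e r : ev e r -> derivable 7 (code_expr e) (code_expr r) 0 0.
Proof.
  induction 1 as
    [v Hv | | e1 e2 x b v r _ IH1 _ IH2 Hv _ IH3
    | e1 e2 v1 v2 _ IH1 Hv1 Hm _ IH2 Hv2 | e1 e2 _ IH | e1 e2 _ IH
    | o e1 e2 v1 v2 _ IH1 Hv1 _ IH2 Hv2 | o e1 e2 _ IH
    | o e1 e2 v1 _ IH1 Hv1 _ IH2 | e0 e1 e2 b r _ IH1 _ IH2
    | e0 e1 e2 v _ IH Hv Hm | e0 e1 e2 _ IH | e p v _ IH Hv | e p _ IH | n | b].
  - apply derivable_value in Hv. by_clause [code_expr v].
  - by_clause (@nil nat).
  - apply derivable_value in Hv. pose proof (derivable_subst x v b).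
    by_clause [code_expr e1; code_expr e2; x; code_expr b; code_expr v;
      code_expr (subst x v b); code_expr r].
  - pose proof (derivable_matches v1 PFun Hv1) as Hd. rewrite Hm in Hd.
    apply derivable_value in Hv1, Hv2.
    by_clause [code_expr e1; code_expr e2; code_expr v1; code_expr v2].
  - by_clause [code_expr e1; code_expr e2].
  - by_clause [code_expr e1; code_expr e2].
  - pose proof (derivable_delta o v1 v2 Hv1 Hv2).
    apply derivable_value in Hv1, Hv2.
    by_clause [code_op o; code_expr e1; code_expr e2; code_expr v1; code_expr v2;
      code_expr (delta o v1 v2)].
  - by_clause [code_op o; code_expr e1; code_expr e2].
  - apply derivable_value in Hv1.
    by_clause [code_op o; code_expr e1; code_expr e2; code_expr v1].
  - destruct b; by_clause [code_expr e0; code_expr e1; code_expr e2; code_expr r].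
  - pose proof (derivable_matches v PBool Hv) as Hd. rewrite Hm in Hd.
    apply derivable_value in Hv.
    by_clause [code_expr e0; code_expr e1; code_expr e2; code_expr v].
  - by_clause [code_expr e0; code_expr e1; code_expr e2].
  - pose proof (derivable_matches v p Hv) as Hd. apply derivable_value in Hv.
    by_clause [code_expr e; code_pat p; code_expr v; code_bool (matches v p)].
  - by_clause [code_expr e; code_pat p].
  - unfold derivable. unfold code_expr at 2.
    destruct (Z_cases n) as [[m ->] | [m ->]];
      rewrite ?code_Z_nonneg, ?code_Z_neg; by_clause [m].
  - destruct b; by_clause (@nil nat).
Qed.

Lemma derivable_mem x l : In x l -> derivable 8 x (code_list l) 0 0.
Proof.
  induction l as [| y l IH]; intros H; [easy |]. destruct H as [-> | H].
  - by_clause [x; code_list l].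
  - apply IH in H. by_clause [x; y; code_list l].
Qed.

Lemma derivable_scoped e l :
  (forall x, free x e -> In x l) -> derivable 9 (code_list l) (code_expr e) 0 0.
Proof.
  revert l. induction e as [n | b | y e IH | y | e1 IH1 e2 IH2 | o e1 IH1 e2 IH2
    | e0 IH0 e1 IH1 e2 IH2 | e IH p | | |]; intros l H; cbn [free] in H.
  - unfold derivable, code_expr. destruct (Z_cases n) as [[m ->] | [m ->]];
      rewrite ?code_Z_nonneg, ?code_Z_neg; by_clause [code_list l; m].
  - destruct b; by_clause [code_list l].
  - assert (derivable 9 (code_list (y :: l)) (code_expr e) 0 0).
    { apply IH. intros x Hx. destruct (Nat.eq_dec x y); cbn; auto. }
    by_clause [code_list l; y; code_expr e].
  - specialize (H y eq_refl). apply derivable_mem in H.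
    by_clause [code_list l; y].
  - specialize (IH1 l ltac:(auto)). specialize (IH2 l ltac:(auto)).
    by_clause [code_list l; code_expr e1; code_expr e2].
  - specialize (IH1 l ltac:(auto)). specialize (IH2 l ltac:(auto)).
    destruct o; by_clause [code_list l; code_expr e1; code_expr e2].
  - specialize (IH0 l ltac:(auto)). specialize (IH1 l ltac:(auto)).
    specialize (IH2 l ltac:(auto)).
    by_clause [code_list l; code_expr e0; code_expr e1; code_expr e2].
  - specialize (IH l ltac:(auto)).
    destruct p; by_clause [code_list l; code_expr e].
  - by_clause [code_list l].
  - by_clause [code_list l].
  - by_clause [code_list l].
Qed.

Lemma derivable_chk_gen t :
  (forall e, derivable 10 (code_ty t) (code_expr e) (code_expr (chk t e)) 0) /\
  derivable 11 (code_ty t) (code_expr (gen t)) 0 0.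
Proof.
  induction t as [| | t1 [IHc1 IHg1] t2 [IHc2 IHg2]]; split.
  - intros e. by_clause [code_expr e].
  - by_clause (@nil nat).
  - intros e. by_clause [code_expr e].
  - by_clause (@nil nat).
  - intros e. specialize (IHc2 (EApp e (gen t1))).
    by_clause [code_ty t1; code_ty t2; code_expr e; code_expr (gen t1);
      code_expr (chk t2 (EApp e (gen t1)))].
  - specialize (IHc1 (EVar 0)).
    by_clause [code_ty t1; code_ty t2; code_expr (gen t2); code_expr (chk t1 (EVar 0))].
Qed.

Lemma derivable_ill e t :
  closed e -> ev (chk t e) EError -> derivable 12 (code (e, t)) 0 0 0.
Proof.
  intros He H. apply derivable_ev in H.
  pose proof (proj1 (derivable_chk_gen t) e).
  assert (derivable 9 (code_list []) (code_expr e) 0 0).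
  { apply derivable_scoped. intros x Hx. now apply He in Hx. }
  by_clause [code_expr e; code_ty t; code_expr (chk t e)].
Qed.

(** The enumerated set is derivability of the fact with tag 12. Completeness of the program gives
    one inclusion, its soundness the other, and [sem_typed_passes] translates between errors of the
    check and failure of typing. *)
Theorem corollary3p13 :
  co_re_via code
    (fun p => closed (fst p))
    (fun p => sem_typed (fst p) (snd p)).
Proof.
  assert (H : recursively_enumerable (fun m =>
    derives program (cpair 12 (cpair m (cpair 0 (cpair 0 0)))))).
  { apply derives_re. auto using rec1_pair, rec1_const, rec1_id. }
  destruct H as [f Hf]. exists f. intros m. rewrite <- Hf. split.
  - intros ([e t] & [Hc Hs] & ->). cbn in *.
    apply derivable_ill; auto.
    (* [passes] is a negation, so its failure yields an actual run to [EError] only classically. *)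
    apply NNPP. intros Hn. now apply Hs, sem_typed_passes.
  - intros H. apply program_sound in H. rewrite holds_fact in H.
    destruct H as ([e t] & Hm & Hc & H). exists (e, t). cbn in *.
    repeat split; auto. intros Hs. now apply sem_typed_passes in Hs.
Qed.
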